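(* There exists a universal constant $C_0>0$ such that the following holds for every integer $B\ge 1$. Let $N=\frac{B(2B-1)(2B+1)}{3}$ be the total number of Wigner-D functions $\mathrm{D}_l^{k,n}(\theta,\phi,\chi)$ of degree less than $B$ (that is, $0\le l\le B-1$, $-l\le k,n\le l$). Then the preconditioned functions $$(\theta,\phi,\chi)\mapsto(\sin\theta)^{1/2}\,\mathrm{D}_l^{k,n}(\theta,\phi,\chi),\qquad 0\le l\le B-1,\ -l\le k,n\le l,$$ are orthonormal (an orthonormal basis of their span) with respect to the product measure $\mathrm{d}\nu=\mathrm{d}\theta\,\mathrm{d}\phi\,\mathrm{d}\chi$ on $[0,\pi]\times[0,2\pi)\times[0,2\pi)$, and they satisfy $$\sup_{0\le l\le B-1,\ -l\le k,n\le l}\ \big\|(\sin\theta)^{1/2}\,\mathrm{D}_l^{k,n}(\theta,\phi,\chi)\big\|_\infty\ \le\ C_0\,N^{1/12},$$ where $\|\cdot\|_\infty$ is the supremum over $[0,\pi]\times[0,2\pi)\times[0,2\pi)$.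
   Context: Wigner-D functions. For integers $l\ge 0$ and $-l\le k,n\le l$, the Wigner-D function of degree $l$ and orders $k,n$ is, for $\theta\in[0,\pi]$ and $\phi,\chi\in[0,2\pi)$ (Euler angles on $\mathrm{SO}(3)$), $$\mathrm{D}_l^{k,n}(\theta,\phi,\chi)=N_l\, e^{-jk\phi}\,\mathrm{d}_l^{k,n}(\cos\theta)\,e^{-jn\chi},\qquad N_l=\sqrt{\tfrac{2l+1}{8\pi^2}},$$ where $j$ is the imaginary unit and $\mathrm{d}_l^{k,n}$ is the Wigner-d function $$\mathrm{d}_l^{k,n}(\cos\theta)=\omega\sqrt{\Gamma}\,\sin^{\mu}\!\big(\tfrac{\theta}{2}\big)\cos^{\lambda}\!\big(\tfrac{\theta}{2}\big)P_{\alpha}^{(\mu,\lambda)}(\cos\theta),$$ with $\mu=|k-n|$, $\lambda=|k+n|$, $\alpha=l-\frac{\mu+\lambda}{2}$, $\Gamma=\frac{\alpha!\,(\alpha+\mu+\lambda)!}{(\alpha+\mu)!\,(\alpha+\lambda)!}$, $\omega=1$ if $n\ge k$ and $\omega=(-1)^{n-k}$ if $n<k$, and $P_\alpha^{(\mu,\lambda)}$ the (standardly normalized) Jacobi polynomial of degree $\alpha$. Here the product measure $\mathrm{d}\nu=\mathrm{d}\theta\,\mathrm{d}\phi\,\mathrm{d}\chi$ is Lebesgue measure, not normalized. ''Universal'' means not depending on $B,N,l,k,n$. *)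

(* Defs.v *)
From HB Require Import structures.
From mathcomp Require Import all_boot all_order all_algebra.
From mathcomp Require Import complex.
From mathcomp Require Import all_classical all_reals all_analysis.
From mathcomp Require Import zify.

Set Implicit Arguments.
Unset Strict Implicit.
Unset Printing Implicit Defensive.

Import Order.TTheory GRing.Theory Num.Theory.
Import numFieldNormedType.Exports.

Local Open Scope classical_set_scope.
Local Open Scope ring_scope.
Local Open Scope complex_scope.

(* The standardly normalized Jacobi polynomial P_n^(a,b), for a, b natural:
   sum_s binom(n+a, n-s) binom(n+b, s) ((x-1)/2)^s ((x+1)/2)^(n-s),
   so that P_n^(a,b)(1) = binom(n+a, n). *)
Definition jacobi (R : realType) (n a b : nat) : {poly R} :=
  \sum_(s < n.+1) ('C(n + a, n - s) * 'C(n + b, s))%:R *: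
    ((2^-1 *: ('X - 1)) ^+ s * (2^-1 *: ('X + 1)) ^+ (n - s)).

(* [wigner_d l k n t] is d_l^{k,n}(cos t). The sum mu + lambda equals
   2 max(|k|, |n|), so for -l <= k, n <= l neither the halving nor the
   subtraction in [alpha] truncates. *)
Definition wigner_d (R : realType) (l : nat) (k n : int) (t : R) : R :=
  let mu := absz (k - n) in
  let lambda := absz (k + n) in
  let alpha := (l - (mu + lambda)./2)%N in
  let Gamma : R := (alpha`! * (alpha + mu + lambda)`!)%:R
                   / ((alpha + mu)`! * (alpha + lambda)`!)%:R in
  let omega : R := if k <= n then 1 else (-1) ^ (n - k) in
  omega * Num.sqrt Gamma * sin (t / 2) ^+ mu * cos (t / 2) ^+ lambda
  * (jacobi R alpha mu lambda).[cos t].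

(* e^{j t} *)
Definition expj (R : realType) (t : R) : R[i] := cos t +i* sin t.

Definition wigner_D (R : realType) (l : nat) (k n : int) (t p c : R) : R[i] :=
  (Num.sqrt ((2 * l + 1)%:R / (8 * pi ^+ 2)))%:C * expj (- (k%:~R * p))
  * (wigner_d l k n t)%:C * expj (- (n%:~R * c)).

(* The triples (l, k, n) with 0 <= l < B and -l <= k, n <= l; the orders are
   encoded by their offsets from -l. *)
Definition wigner_idx (B : nat) : finType :=
  {l : 'I_B & ('I_(2 * l).+1 * 'I_(2 * l).+1)%type}.

Definition idx_l (B : nat) (i : wigner_idx B) : nat := tag i.
Definition idx_k (B : nat) (i : wigner_idx B) : int :=
  ((tagged i).1 : nat)%:Z - (idx_l i)%:Z.
Definition idx_n (B : nat) (i : wigner_idx B) : int :=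
  ((tagged i).2 : nat)%:Z - (idx_l i)%:Z.

Lemma wigner_idxP (B l : nat) (k n : int) :
  (exists! i : wigner_idx B, [/\ idx_l i = l, idx_k i = k & idx_n i = n]) <->
  [/\ (l < B)%N, - l%:Z <= k <= l%:Z & - l%:Z <= n <= l%:Z].
Proof.
rewrite /idx_k /idx_n /idx_l; split.
  move=> [[l' [a b]] /= [[<- <- <-] _]].
  have /= ha := ltn_ord a; have /= hb := ltn_ord b.
  by split; [exact: ltn_ord | lia | lia].
move=> [lB hk hn].
have ak : (absz (k + l%:Z)%R < (2 * Ordinal lB).+1)%N by rewrite /=; lia.
have an : (absz (n + l%:Z)%R < (2 * Ordinal lB).+1)%N by rewrite /=; lia.
exists (Tagged (fun l : 'I_B => 'I_(2 * l).+1 * 'I_(2 * l).+1)%type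
          (Ordinal ak, Ordinal an)); split=> [|[l' [a b]] /= [e1 e2 e3]].
  by split=> //=; lia.
have El : Ordinal lB = l' by exact: val_inj.
subst l'.
have -> : a = Ordinal ak by apply: val_inj => /=; move: e2 => /=; lia.
have -> : b = Ordinal an by apply: val_inj => /=; move: e3 => /=; lia.
by [].
Qed.

(* R x R x R with the Borel sigma-algebra on each factor. *)
Notation R3 R :=
  (measurableTypeR R * measurableTypeR R * measurableTypeR R)%type.

Definition wigner_pre (R : realType) (B : nat) (i : wigner_idx B)
    (x : R3 R) : R[i] :=
  (Num.sqrt (sin x.1.1))%:C
  * wigner_D (idx_l i) (idx_k i) (idx_n i) x.1.1 x.1.2 x.2.

Definition euler_dom (R : realType) : set (R3 R) :=
  (`[0, pi]%classic `*` `[0, 2 * pi[%classic) `*` `[0, 2 * pi[%classic.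

Arguments euler_dom : clear implicits.

Definition nu (R : realType) : {measure set (R3 R) -> \bar R} :=
  ((@lebesgue_measure R \x @lebesgue_measure R) \x @lebesgue_measure R)%E.

Section L2.
Context {R : realType} {d : measure_display} {T : measurableType d}.
Variables (mu : {measure set T -> \bar R}) (D : set T).

Definition cRe (f : T -> R[i]) (x : T) : R := complex.Re (f x).
Definition cIm (f : T -> R[i]) (x : T) : R := complex.Im (f x).

Definition in_L2 (f : T -> R[i]) : Prop :=
  [/\ measurable_fun D (cRe f), measurable_fun D (cIm f)
    & mu.-integrable D (fun x => (Normc.normc (f x) ^+ 2)%:E)].

Definition cintegral (f : T -> R[i]) : R[i] :=
  (\int[mu]_(x in D) cRe f x)%R +i* (\int[mu]_(x in D) cIm f x)%R.

Definition inner (f g : T -> R[i]) : R[i] :=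
  cintegral (fun x => f x * conjc (g x)).

Definition orthonormal_family (I : finType) (e : I -> T -> R[i]) : Prop :=
  (forall i, in_L2 (e i)) /\ forall i j, inner (e i) (e j) = (i == j)%:R.

Definition is_lincomb (I : finType) (e : I -> T -> R[i]) (c : {ffun I -> R[i]})
    (f : T -> R[i]) : Prop :=
  forall x, D x -> f x = \sum_i c i * e i x.

Definition fspan (I : finType) (e : I -> T -> R[i]) : set (T -> R[i]) :=
  [set f | exists c, is_lincomb e c f].

Definition orthonormal_basis (V : set (T -> R[i])) (I : finType)
    (e : I -> T -> R[i]) : Prop :=
  [/\ orthonormal_family e, forall i, V (e i)
    & forall f, V f -> exists! c, is_lincomb e c f].

Definition sup_norm (f : T -> R[i]) : \bar R :=
  ereal_sup [set (Normc.normc (f x))%:E | x in D].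

End L2.

(* Main.v *)
Require Import Defs.
From HB Require Import structures.
From mathcomp Require Import all_boot all_order all_algebra.
From mathcomp Require Import complex.
From mathcomp Require Import all_classical all_reals all_analysis.
From mathcomp Require Import measurable_realfun.
From mathcomp Require Import zify ring lra.

Set Implicit Arguments.
Unset Strict Implicit.
Unset Printing Implicit Defensive.

Import Order.TTheory GRing.Theory Num.Theory.
Import numFieldNormedType.Exports.

Local Open Scope classical_set_scope.
Local Open Scope ring_scope.

(* Put y = sin^2(t/2), x = cos t, c = cos(t/2), s = sin(t/2), n = 2l.

   Orthonormality: the integrals over phi and chi are elementary, and the
   integral over t is the orthogonality of the Jacobi polynomials on [0, 1] for
   the Beta weight, obtained from Rodrigues' formula by integrating by parts.

   Sup bound: with a = alpha + mu and b = alpha + lambda, d_l^{k,n}(x) is, up to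
   sign, sqrt(Gamma) times the coefficient of X^alpha in (c X + s)^a (c - s X)^b.
   Cauchy's formula on the circle of radius r bounds this coefficient by the
   mean over phi of (1 + r^2)^l sqrt(G(u)), where G(u) = u^a (1 - u)^b and u is
   an affine function of cos phi, of slope proportional to sin t. Bounding
   sqrt(G(u)) trivially where sin phi is small, and turning the rest into the
   integral of G over [0, 1], which is a Beta integral, gives a bound in which
   all factorials but the binomial weight
   binom(n, alpha) x^(alpha + 1/2) (1 - x)^(n - alpha + 1/2) cancel. Choosing r
   so that this weight is near its maximum, of order n^(-1/2), yields
   sin t d_l^{k,n}(cos t)^2 = O(l^(-1/2)), hence the exponent 1/4 in l, that is
   1/12 in N. *)

(** * Maximum of a binomial weight *)

(** Truncated binomial expansion. Multiplying the bound for [N] by 1 + x gives the bound for [N.+1]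
    plus N(N-1)(N-2)/6 x^4, which is nonnegative. The cubic order matters in [peak_ratio_decr],
    where the two sides agree to second order in 1/K. *)
Lemma bernoulli3 (R : realFieldType) (x : R) (N : nat) : 0 <= x ->
  1 + N%:R * x + N%:R * (N%:R - 1) / 2 * x ^+ 2
    + N%:R * (N%:R - 1) * (N%:R - 2) / 6 * x ^+ 3 <= (1 + x) ^+ N.
Proof.
move=> x0; elim: N => [|N IH]; first by rewrite expr0; lra.
have P0 : 0 <= N%:R * (N%:R - 1) * (N%:R - 2) :> R.
  (* For N = 0 and N = 1 a factor vanishes; from 2 on all factors are nonnegative. *)
  case: N {IH} => [|[|N]]; [by lra|by lra|].
  rewrite !mulr_ge0 ?ler0n // ?subr_ge0 ?ler1n // ler_nat //.
have x1 : 0 <= 1 + x by lra.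
rewrite [leRHS]exprS; apply: le_trans _ (ler_wpM2l x1 IH).
have P1 : 0 <= N%:R * (N%:R - 1) * (N%:R - 2) * x ^+ 4 :> R.
  by rewrite mulr_ge0 // exprn_ge0.
rewrite -natr1; set M := N%:R in P1 *; rewrite -subr_ge0.
apply: le_trans (_ : M * (M - 1) * (M - 2) * x ^+ 4 / 6 <= _); first lra.
by rewrite le_eqVlt; apply/orP; left; apply/eqP; field.
Qed.

(** With K = k + 1 this is (1 + 1/K)^(2K+1), which decreases from 8 to e^2. *)
Definition peak_ratio (R : realFieldType) (k : nat) : R :=
  (k.+2%:R / k.+1%:R) ^+ (2 * k + 3).

(** Since (K+1)/K = (K+2)/(K+1) (1 + x) with x = 1/(K(K+2)), the claim reduces to ((K+2)/(K+1))^2 <=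
    (1 + x)^(2K+1), which [bernoulli3] settles. *)
Lemma peak_ratio_decr (R : realFieldType) (k : nat) : peak_ratio R k.+1 <= peak_ratio R k.
Proof.
rewrite /peak_ratio.
have -> : (2 * k.+1 + 3 = (2 * k + 3) + 2)%N by lia.
set N := (2 * k + 3)%N.
pose K : R := k.+1%:R.
have K1 : 1 <= K by rewrite ler1n.
have e2 : k.+2%:R = K + 1 by rewrite /K natr1.
have e3 : k.+3%:R = K + 2 by rewrite /K -natrD addn2.
rewrite e2 e3.
have NE : N%:R = 2 * K + 1 by rewrite /N /K -natr1 natrD natrM; ring.
pose x : R := (K * (K + 2))^-1.
have x0 : 0 <= x by rewrite invr_ge0; nra.
have -> : (K + 1) / k.+1%:R = (K + 2) / (K + 1) * (1 + x).
  by rewrite -/K /x; field; lra.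
rewrite [leRHS]exprMn [leLHS]exprD ler_wpM2l //; first by rewrite exprn_ge0 // divr_ge0; lra.
apply: le_trans (bernoulli3 _ x0); rewrite NE -subr_ge0.
have -> : 1 + (2 * K + 1) * x + (2 * K + 1) * (2 * K + 1 - 1) / 2 * x ^+ 2 +
  (2 * K + 1) * (2 * K + 1 - 1) * (2 * K + 1 - 2) / 6 * x ^+ 3 -
  ((K + 2) / (K + 1)) ^+ 2 = (K ^+ 4 + 5 * K ^+ 3 + 18 * K ^+ 2 + 16 * K - 1)
   / (3 * K ^+ 2 * (K + 2) ^+ 3 * (K + 1) ^+ 2).
  rewrite /x; field; lra.
have K0 : 0 <= K by lra.
rewrite divr_ge0 ?mulr_ge0 ?exprn_ge0 //; try lra.
have := exprn_ge0 4 K0; have := exprn_ge0 3 K0; have := exprn_ge0 2 K0; lra.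
Qed.

Lemma peak_ratio_antitone (R : realFieldType) (i j : nat) :
  (i <= j)%N -> peak_ratio R j <= peak_ratio R i.
Proof.
move=> /subnK <-; elim: (j - i)%N => // d IH.
by rewrite addSn; apply: le_trans (peak_ratio_decr R _) IH.
Qed.

(** The square of (m+1)^(m+1/2) / m!, the contribution of one of the two exponents to the binomial
    weight near its maximum. *)
Definition peak (R : realFieldType) (m : nat) : R :=
  m.+1%:R ^+ (2 * m + 1) / (m`!)%:R ^+ 2.

Lemma peakS (R : realFieldType) (m : nat) :
  peak R m.+1 = peak R m * peak_ratio R m.
Proof.
rewrite /peak /peak_ratio expr_div_n factS natrM.
have -> : (2 * m.+1 + 1 = 2 * m + 3)%N by lia.
have -> : m.+1%:R ^+ (2 * m + 3) = m.+1%:R ^+ (2 * m + 1) * m.+1%:R ^+ 2 :> R.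
  by rewrite -exprD; congr (_ ^+ _); lia.
field; rewrite pnatr_eq0 -lt0n fact_gt0 /=.
by rewrite expf_neq0 // nat1r pnatr_eq0.
Qed.

Lemma peak_gt0 (R : realFieldType) (m : nat) : 0 < peak R m.
Proof. by rewrite divr_gt0 // exprn_gt0 // ltr0n // fact_gt0. Qed.

(** Raising p by one multiplies the left side by [peak_ratio R (m + p)] and the right side by
    [peak_ratio R p], which is at least as large. *)
Lemma peak_supermul (R : realFieldType) (m p : nat) :
  peak R (m + p) <= peak R m * peak R p.
Proof.
elim: p => [|p IH].
  by rewrite addn0 [peak R 0]/peak fact0 !expr1n divr1 mulr1.
rewrite addnS !peakS mulrA ler_pM ?peak_ratio_antitone ?leq_addl //.
  exact/ltW/peak_gt0.
by rewrite exprn_ge0 // divr_ge0.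
Qed.

(* The maximum over x of binom(m+p, m) x^(m+1/2) (1-x)^(p+1/2) is bounded
   below by a multiple of (m+p+1)^(-1/2); the value is taken at
   x = (m+1)/(m+p+2), and everything is squared. *)
Lemma binomial_peak (R : realFieldType) (m p : nat) :
  (m + p).+2%:R ^+ (2 * (m + p) + 2) * ((m`!)%:R ^+ 2 * (p`!)%:R ^+ 2)
  <= 8 * (m + p).+1%:R * ((m + p)`!)%:R ^+ 2
     * (m.+1%:R ^+ (2 * m + 1) * p.+1%:R ^+ (2 * p + 1)) :> R.
Proof.
set n := (m + p)%N.
have f0 (k : nat) : 0 < (k`!)%:R ^+ 2 :> R by rewrite exprn_gt0 // ltr0n fact_gt0.
have H := peak_supermul R m p; rewrite -/n /peak mulrACA -invfM in H.
rewrite ler_pdivrMr ?f0 // [leRHS]mulrAC ler_pdivlMr ?mulr_gt0 ?f0 // in H.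
have S : peak_ratio R n <= 8.
  by apply: le_trans (peak_ratio_antitone R (leq0n n)) _; rewrite /peak_ratio /= divr1; lra.
(* The ratio (n+2)/(n+1) is at least 1, so its power 2n+2 is at most its power 2n+3, which is
   [peak_ratio R n]. *)
have H2 : n.+2%:R ^+ (2 * n + 2) <= 8 * n.+1%:R ^+ (2 * n + 2) :> R.
  rewrite -ler_pdivrMr ?exprn_gt0 // -expr_div_n; apply: le_trans S.
  rewrite /peak_ratio ler_weXn2l //; last lia.
  by rewrite ler_pdivlMr // mul1r ler_nat.
apply: le_trans (ler_wpM2r _ H2) _; first by rewrite mulr_ge0 ?ltW ?f0.
have -> : n.+1%:R ^+ (2 * n + 2) = n.+1%:R ^+ (2 * n + 1) * n.+1%:R :> R.
  by rewrite -exprSr; congr (_ ^+ _); lia.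
have c0 : 0 <= 8 * n.+1%:R :> R by rewrite mulr_ge0.
have := ler_wpM2l c0 H.
move: (n.+1%:R ^+ (2 * n + 1)) (m.+1%:R ^+ _) (p.+1%:R ^+ _).
move: (m`!%:R ^+ 2) (p`!%:R ^+ 2) (n`!%:R ^+ 2) (n.+1%:R : R) => x1 x2 x3 x4 x5 x6 x7.
lra.
Qed.

(** * Integration of polynomials over [0, 1] *)

Section Primitive.
Variable R : numFieldType.
Implicit Types p q : {poly R}.

(* At i = 0 the quotient is the junk value p`_0 / 0 = 0, so that
   [coef_primitive] needs no case distinction. *)
Definition primitive p : {poly R} := \poly_(i < (size p).+1) (p`_i.-1 / i%:R).

Lemma coef_primitive p i : (primitive p)`_i = p`_i.-1 / i%:R.
Proof.
rewrite coef_poly ltnS; case: leqP => // lt_pi.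
by rewrite nth_default ?mul0r //; case: i lt_pi.
Qed.

Lemma deriv_primitive p : (primitive p)^`() = p.
Proof.
apply/polyP=> i; rewrite coef_deriv coef_primitive /=.
by rewrite -[LHS]mulr_natr divfK // pnatr_eq0.
Qed.

Lemma primitive_deriv p : primitive p^`() = p - (p`_0)%:P.
Proof.
apply/polyP=> -[|i]; rewrite coef_primitive coefB coefC /=.
  by rewrite invr0 mulr0 subrr.
by rewrite coef_deriv subr0 -[_ *+ _]mulr_natr mulfK // pnatr_eq0.
Qed.

Lemma primitive_is_linear : linear primitive.
Proof.
move=> a p q; apply/polyP=> i.
by rewrite !(coefD, coefZ, coef_primitive) mulrDl mulrA.
Qed.

(** The integral over [0, 1], because [primitive p] vanishes at 0. *)
Definition pint p : R := (primitive p).[1].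

Lemma pint_is_scalar : scalar pint.
Proof. by move=> a p q; rewrite /pint primitive_is_linear hornerD hornerZ. Qed.

HB.instance Definition _ :=
  GRing.isLinear.Build R {poly R} R _ pint pint_is_scalar.

Lemma pintZ a p : pint (a *: p) = a * pint p.
Proof. by rewrite linearZ. Qed.

Lemma horner_primitive0 p : (primitive p).[0] = 0.
Proof. by rewrite horner_coef0 coef_primitive invr0 mulr0. Qed.

Lemma pint_deriv p : pint p^`() = p.[1] - p.[0].
Proof. by rewrite /pint primitive_deriv hornerD hornerN hornerC horner_coef0. Qed.

Lemma pint_by_parts p q :
  pint (p^`() * q) = p.[1] * q.[1] - p.[0] * q.[0] - pint (p * q^`()).
Proof. by rewrite -!hornerM -pint_deriv -linearB /= derivM addrK. Qed.

(** Beta integral: each integration by parts moves one power from 1 - X to X. *)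
Lemma pint_beta (a b : nat) :
  pint ('X^a * (1 - 'X) ^+ b) = (a`! * b`!)%:R / (a + b).+1`!%:R.
Proof.
have XnE (k : nat) : 'X^k = k.+1%:R^-1 *: ('X^(k.+1))^`() :> {poly R}.
  by rewrite derivXn -[X in _ *: X]scaler_nat scalerA mulVf ?pnatr_eq0 // scale1r.
elim: b a => [|b IH] a.
  rewrite expr0 mulr1 addn0 fact0 muln1 factS natrM invfM mulrCA divff ?mulr1.
    by rewrite XnE linearZ /= pint_deriv !hornerE expr1n expr0n /= subr0 mulr1.
  by rewrite pnatr_eq0 -lt0n fact_gt0.
rewrite XnE -scalerAl.
have dE : ((1 - 'X : {poly R}) ^+ b.+1)^`() = - b.+1%:R *: (1 - 'X) ^+ b.
  rewrite deriv_exp derivB derivX derivC sub0r /= mulN1r mulNrn.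
  by rewrite -[X in - X]scaler_nat scaleNr.
rewrite pintZ pint_by_parts dE -scalerAr pintZ IH addSnnS !hornerE.
rewrite subrr !expr0n /= !(mulr0, mul0r) subrr sub0r !factS !natrM.
have nz (k : nat) : k.+1%:R != 0 :> R by rewrite pnatr_eq0.
have fz (k : nat) : k`!%:R != 0 :> R by rewrite pnatr_eq0 -lt0n fact_gt0.
move: (fz (a + b.+1)%N) (nz (a + b.+1)%N) (nz a).
rewrite -[(a + b.+1).+1%:R]nat1r natrD -[b.+1%:R]nat1r -[a.+1%:R]nat1r => h1 h2 h3.
by field; rewrite h1 h2 h3.
Qed.

End Primitive.

(** * Orthogonality of the Jacobi polynomials *)

Lemma derivnM (R : comNzRingType) (p q : {poly R}) (n : nat) :
  (p * q)^`(n) = \sum_(i < n.+1) (p^`(n - i) * q^`(i)) *+ 'C(n, i).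
Proof.
elim: n => [|n IH]; first by rewrite big_ord_recl big_ord0 /= addr0 bin0 mulr1n.
rewrite derivnS IH raddf_sum /=.
under eq_bigr do rewrite derivMn derivM mulrnDl -!derivnS.
rewrite big_split /= [RHS]big_ord_recl /= bin0 mulr1n.
under [in RHS]eq_bigr do rewrite /bump leq0n add1n subSS binS mulrnDr.
rewrite big_split /= addrA; congr (_ + _).
rewrite big_ord_recl /= bin0 mulr1n subn0; congr (_ + _).
rewrite [RHS]big_ord_recr /= bin_small // mulr0n addr0.
by apply: eq_bigr => i _; rewrite /bump leq0n add1n -derivnS subnSK.
Qed.

Lemma derivn_exp_onemX (R : comNzRingType) (m i : nat) :
  ((1 - 'X : {poly R}) ^+ m)^`(i) = ((-1) ^+ i * (m ^_ i)%:R) *: (1 - 'X) ^+ (m - i).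
Proof.
elim: i => [|i IH]; first by rewrite expr0 ffactn0 mul1r scale1r subn0.
rewrite derivnS IH derivZ deriv_exp derivB derivX derivC sub0r mulN1r mulNrn.
rewrite -[X in _ *: - X]scaler_nat -scaleNr scalerA -subnS ffactnSr exprS natrM.
by congr (_ *: _); ring.
Qed.

(** Each derivative costs at most one factor [p]. This makes the boundary terms vanish in the
    repeated integration by parts. *)
Lemma derivn_expM_dvd (R : comNzRingType) (p q : {poly R}) (k i : nat) :
  exists r, (p ^+ k * q)^`(i) = p ^+ (k - i) * r.
Proof.
elim: i => [|i [r IH]]; first by exists q; rewrite derivn0 subn0.
rewrite derivnS IH derivM deriv_exp.
case E : (k - i)%N => [|j].
  exists r^`(); have -> : (k - i.+1 = 0)%N by lia.
  by rewrite !expr0 mulr0n mul0r add0r.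
exists ((p^`() * r) *+ j.+1 + p * r^`()); have -> : (k - i.+1 = j)%N by lia.
rewrite /= exprS; ring.
Qed.

Section JacobiOrthogonality.
Variable R : realFieldType.

(* P_n^(a,b)(1 - 2 y), as a polynomial in y *)
Definition jacobi01 (n a b : nat) : {poly R} :=
  \sum_(s < n.+1) ('C(n + a, n - s) * 'C(n + b, s))%:R *:
    ((- 'X) ^+ s * (1 - 'X) ^+ (n - s)).

Definition jweight (a b : nat) : {poly R} := 'X^a * (1 - 'X) ^+ b.

(** Leibniz' rule on the right matches the sum defining [jacobi01] term by term. In the variable y =
    (1 - x)/2 the usual sign (-1)^n disappears. *)
Lemma jacobi01_Rodrigues n a b :
  n`!%:R *: (jweight a b * jacobi01 n a b) = (jweight (n + a) (n + b))^`(n).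
Proof.
rewrite /jweight /jacobi01 derivnM mulr_sumr scaler_sumr; apply: eq_bigr => s _.
have sn : (s <= n)%N by rewrite -ltnS.
rewrite derivnXn derivn_exp_onemX.
have -> : (n + a - (n - s) = a + s)%N by lia.
have -> : (n + b - s = b + (n - s))%N by lia.
have -> : (- 'X : {poly R}) ^+ s = (-1) ^+ s *: 'X^s by rewrite -scaleN1r exprZn.
rewrite -[_ *+ 'C(n, s)]scaler_nat -[_ *+ _ ^_ _]scaler_nat.
rewrite -!(scalerAl, scalerAr) !scalerA.
congr (_ *: _); last by rewrite !exprD; ring.
by rewrite -(bin_fact sn) -!bin_ffact !natrM; ring.
Qed.

Lemma size_jacobi01 n a b : (size (jacobi01 n a b) <= n.+1)%N.
Proof.
rewrite /jacobi01; apply: (leq_trans (size_sum _ _ _)).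
apply/bigmax_leqP => s _; apply: (leq_trans (size_scale_leq _ _)).
apply: (leq_trans (size_polyMleq _ _)).
have h1 : (size ((- 'X : {poly R}) ^+ s) <= s.+1)%N.
  by apply: (leq_trans (size_poly_exp_leq _ _)); rewrite size_polyN size_polyX mul1n.
have h2 : (size ((1 - 'X : {poly R}) ^+ (n - s)) <= (n - s).+1)%N.
  apply: (leq_trans (size_poly_exp_leq _ _)).
  by rewrite -size_polyN opprB size_XsubC mul1n.
have := ltn_ord s; move: h1 h2; set u := size _; set v := size _; lia.
Qed.

Lemma coef_onemX_exp (k : nat) : ((1 - 'X : {poly R}) ^+ k)`_k = (-1) ^+ k.
Proof.
elim: k => [|k IH]; first by rewrite !expr0 coef1.
rewrite exprS mulrBl mul1r coefB coefXM /= IH.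
rewrite nth_default ?exprS; first by ring.
by rewrite (leq_trans (size_poly_exp_leq _ _)) // -size_polyN opprB size_XsubC mul1n.
Qed.

(** The signs (-1)^s and (-1)^(n-s) combine to (-1)^n, and the products of binomials add up by
    Vandermonde's convolution. *)
Lemma lead_jacobi01 n a b :
  (jacobi01 n a b)`_n = (-1) ^+ n * 'C(2 * n + a + b, n)%:R.
Proof.
have -> : (2 * n + a + b = (n + b) + (n + a))%N by lia.
rewrite /jacobi01 coef_sum -binomial.Vandermonde natr_sum mulr_sumr.
apply: eq_bigr => s _; have sn : (s <= n)%N by rewrite -ltnS.
have -> : (- 'X : {poly R}) ^+ s = (-1) ^+ s *: 'X^s by rewrite -scaleN1r exprZn.
rewrite coefZ -scalerAl coefZ coefXnM ltnNge sn /= coef_onemX_exp -exprD subnKC //.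
by rewrite mulrC [in RHS]mulnC.
Qed.

(** Integrate by parts n times: derivatives of the weight of order below n keep a factor X and a
    factor 1 - X, so they vanish at 0 and at 1. *)
Lemma pint_derivn_jweight (n a b : nat) (q : {poly R}) :
  pint ((jweight (n + a) (n + b))^`(n) * q)
  = (-1) ^+ n * pint (jweight (n + a) (n + b) * q^`(n)).
Proof.
set W := jweight _ _.
suff H i : (i <= n)%N -> pint (W^`(n) * q) = (-1) ^+ i * pint (W^`(n - i) * q^`(i)).
  by rewrite (H n) // subnn derivn0.
have W0 j : (j < n)%N -> W^`(j).[0] = 0 /\ W^`(j).[1] = 0.
  move=> jn; split.
    have [r ->] := derivn_expM_dvd 'X ((1 - 'X : {poly R}) ^+ (n + b)) (n + a) j.
    by rewrite hornerM hornerXn expr0n subn_eq0 leqNgt ltn_addr ?mul0r.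
  have [r] := derivn_expM_dvd (1 - 'X : {poly R}) 'X^(n + a) (n + b) j.
  rewrite mulrC -/W => ->.
  by rewrite hornerM !hornerE subrr expr0n subn_eq0 leqNgt ltn_addr ?mul0r.
elim: i => [|i IH] ni; first by rewrite expr0 mul1r subn0 derivn0.
rewrite IH; last exact: ltnW.
have -> : (n - i = (n - i.+1).+1)%N by lia.
have [z0 z1] := W0 (n - i.+1)%N ltac:(lia).
rewrite [W^`(_.+1)]derivnS pint_by_parts z0 z1 !mul0r subrr sub0r exprS -derivnS.
by rewrite mulrN mulN1r mulNr.
Qed.

Lemma pint_jacobi01 (n a b : nat) (q : {poly R}) :
  n`!%:R * pint (jweight a b * jacobi01 n a b * q)
  = (-1) ^+ n * pint (jweight (n + a) (n + b) * q^`(n)).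
Proof. by rewrite -pintZ scalerAl jacobi01_Rodrigues pint_derivn_jweight. Qed.

Lemma jacobi01_orth_lt n n' a b : (n' < n)%N ->
  pint (jweight a b * jacobi01 n a b * jacobi01 n' a b) = 0.
Proof.
move=> nn'; have fn : n`!%:R != 0 :> R by rewrite pnatr_eq0 -lt0n fact_gt0.
apply: (mulfI fn); rewrite mulr0 pint_jacobi01 derivn_poly0.
  by rewrite mulr0 linear0 mulr0.
exact: leq_trans (size_jacobi01 _ _ _) nn'.
Qed.

(** By Rodrigues, the factor of higher degree turns into a derivative that kills the other one. For
    equal degrees this derivative is the constant n! times the leading coefficient, and a Beta
    integral remains. *)
Lemma jacobi01_orth n n' a b :
  pint (jweight a b * (jacobi01 n a b * jacobi01 n' a b)) =
  (n == n')%:R * (((n + a)`! * (n + b)`!)%:R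
                  / ((n`! * (n + a + b)`!)%:R * (2 * n + a + b).+1%:R)).
Proof.
rewrite mulrA; case: ltngtP => [nn'|nn'|<-]; last first.
- rewrite mul1r; have fz (k : nat) : k`!%:R != 0 :> R.
    by rewrite pnatr_eq0 -lt0n fact_gt0.
  apply: (mulfI (fz n)); rewrite pint_jacobi01.
  have -> : (jacobi01 n a b)^`(n)
      = ((-1) ^+ n * 'C(2 * n + a + b, n)%:R * n`!%:R)%:P.
    apply/polyP=> -[|i]; rewrite coef_derivn coefC /=.
      by rewrite addn0 lead_jacobi01 ffactnn -[LHS]mulr_natr.
    rewrite nth_default ?mul0rn //.
    by rewrite (leq_trans (size_jacobi01 _ _ _)) // addnS ltnS leq_addr.
  rewrite [_ * _%:P]mulrC mul_polyC pintZ pint_beta.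
  have nle : (n <= 2 * n + a + b)%N by lia.
  have := bin_fact nle; have -> : (2 * n + a + b - n = n + a + b)%N by lia.
  have -> : (n + a + (n + b) = 2 * n + a + b)%N by lia.
  move/(congr1 (fun k : nat => k%:R : R)); rewrite factS !natrM => E.
  have -> : 'C(2 * n + a + b, n)%:R
     = (2 * n + a + b)`!%:R / (n`!%:R * (n + a + b)`!%:R) :> R.
    by rewrite -E mulfK // mulf_neq0.
  have s1 : (-1) ^+ n * (-1) ^+ n = 1 :> R by rewrite -expr2 sqrr_sign.
  rewrite !mulrA s1 mul1r.
  have nz : (2 * n + a + b).+1%:R != 0 :> R by rewrite pnatr_eq0.
  move: (fz n) (fz (n + a)%N) (fz (n + b)%N) (fz (n + a + b)%N) nz (fz (2 * n + a + b)%N).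
  move: (n`!%:R : R) ((n + a)`!%:R : R) ((n + b)`!%:R : R) ((n + a + b)`!%:R : R)
    ((2 * n + a + b).+1%:R : R) ((2 * n + a + b)`!%:R : R).
  move=> x1 x2 x3 x4 x5 x6 h1 h2 h3 h4 h5 h6.
  by field; rewrite h1 h4 h5 h6.
- by rewrite jacobi01_orth_lt // mul0r.
- by rewrite mulrAC jacobi01_orth_lt // mul0r.
Qed.

End JacobiOrthogonality.

(** * Trigonometric polynomials on a circle *)

Section TrigPolynomial.
Variable R : realType.
Local Open Scope complex_scope.

Lemma expjD (x y : R) : expj (x + y) = expj x * expj y.
Proof. by rewrite /expj cosD sinD; apply/eqP; rewrite eq_complex /= eqxx /= addrC [cos x * _]mulrC eqxx. Qed.

Lemma expj0 : expj 0 = 1 :> R[i].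
Proof. by rewrite /expj cos0 sin0. Qed.

Lemma expj_natl (k : nat) (x : R) : expj (k%:R * x) = expj x ^+ k.
Proof.
elim: k => [|k IH]; first by rewrite mul0r expj0 expr0.
by rewrite -natr1 mulrDl mul1r expjD IH exprSr.
Qed.

Lemma normc_sqr (z : R[i]) :
  Normc.normc z ^+ 2 = complex.Re z ^+ 2 + complex.Im z ^+ 2.
Proof. by case: z => x y /=; rewrite sqr_sqrtr // addr_ge0 // sqr_ge0. Qed.

Lemma normc_expj (x : R) : Normc.normc (expj x) = 1.
Proof. by rewrite /= cos2Dsin2 sqrtr1. Qed.

Lemma normcX (z : R[i]) (k : nat) : Normc.normc (z ^+ k) = Normc.normc z ^+ k.
Proof.
elim: k => [|k IH]; first by rewrite !expr0 Normc.normc1.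
by rewrite !exprS Normc.normcM IH.
Qed.

Lemma ReD (z w : R[i]) : complex.Re (z + w) = complex.Re z + complex.Re w.
Proof. by case: z w => ? ? []. Qed.

Lemma ReZ (x : R) (z : R[i]) : complex.Re (x%:C * z) = x * complex.Re z.
Proof. by case: z => ? ? /=; rewrite mul0r subr0. Qed.

(** The rotation by -m phi makes the m-th coefficient the constant term in phi. *)
Lemma trig_polyE (P : {poly R}) (N m : nat) (r phi : R) : (size P <= N)%N ->
  \sum_(j < N) P`_j * r ^+ j * cos ((j%:R - m%:R) * phi) =
  complex.Re ((map_poly (real_complex R) P).[r%:C * expj phi]
              * expj (- (m%:R * phi))).
Proof.
move=> sP; rewrite (@horner_coef_wide _ N) ?size_map_poly // mulr_suml.
rewrite (big_morph (@complex.Re R) ReD (erefl : complex.Re (0 : R[i]) = 0)).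
apply: eq_bigr => j _.
rewrite coef_map exprMn -rmorphXn -!mulrA !ReZ -expj_natl -expjD.
by rewrite mulrBl mulrA.
Qed.

Definition wigner_poly (a b : nat) (c s : R) : {poly R} :=
  (c *: 'X + s%:P) ^+ a * (c%:P - s *: 'X) ^+ b.

Lemma size_wigner_poly a b c s : (size (wigner_poly a b c s) <= (a + b).+1)%N.
Proof.
have s2 (u v : R) (k : nat) : (size ((u *: 'X + v%:P : {poly R}) ^+ k) <= k.+1)%N.
  apply: (leq_trans (size_poly_exp_leq _ _)); rewrite ltnS.
  rewrite -[leqRHS]mul1n leq_mul2r; apply/orP; right.
  rewrite -subn1 leq_subLR; apply: (leq_trans (size_polyD _ _)).
  rewrite geq_max (leq_trans (size_scale_leq _ _)) ?size_polyX //.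
  by rewrite (leq_trans (size_polyC_leq1 _)).
rewrite /wigner_poly; apply: (leq_trans (size_polyMleq _ _)).
have := s2 c s a; have := s2 (- s) c b.
rewrite scaleNr addrC; move: (size _) (size _) => u v; lia.
Qed.

(** A real part is at most the modulus. With z = r e^(j phi), the two bases on the right are |c z +
    s|^2 and |c - s z|^2. *)
Lemma trig_poly_bound a b m (c s r phi : R) :
  (\sum_(j < (a + b).+1) (wigner_poly a b c s)`_j * r ^+ j
      * cos ((j%:R - m%:R) * phi)) ^+ 2 <=
  (c ^+ 2 * r ^+ 2 + s ^+ 2 + 2 * c * s * r * cos phi) ^+ a *
  (c ^+ 2 + s ^+ 2 * r ^+ 2 - 2 * c * s * r * cos phi) ^+ b.
Proof.
rewrite trig_polyE ?size_wigner_poly //.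
set z := (X in complex.Re X).
apply: (@le_trans _ _ (Normc.normc z ^+ 2)).
  by rewrite normc_sqr lerDl sqr_ge0.
rewrite /z Normc.normcM normc_expj mulr1 /wigner_poly rmorphM !rmorphXn /=.
rewrite hornerM !horner_exp Normc.normcM !normcX exprMn -!exprM.
rewrite ![(_ * 2)%N]mulnC !exprM !normc_sqr.
rewrite rmorphD rmorphB /= !map_polyC !map_polyZ map_polyX !hornerE /=.
rewrite !(mul0r, mulr0, subr0, addr0, add0r, sub0r, oppr0).
have e := cos2Dsin2 phi.
rewrite le_eqVlt; apply/orP; left; apply/eqP; congr (_ ^+ a * _ ^+ b).
  apply/eqP; rewrite -subr_eq0.
  rewrite (_ : _ - _ = c ^+ 2 * r ^+ 2 * (cos phi ^+ 2 + sin phi ^+ 2 - 1)).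
    by rewrite e subrr mulr0.
  ring.
apply/eqP; rewrite -subr_eq0.
rewrite (_ : _ - _ = s ^+ 2 * r ^+ 2 * (cos phi ^+ 2 + sin phi ^+ 2 - 1)).
  by rewrite e subrr mulr0.
ring.
Qed.

End TrigPolynomial.

(** * Comparison of increments through derivatives, in place of integral estimates *)

Section DerivativeComparison.
Variable R : realType.

(** Mean value theorem for [H - F]. *)
Lemma ler_diff_derive (F f H h : R -> R) (x y : R) : x <= y ->
  (forall t, is_derive t (1 : R) F (f t)) -> (forall t, is_derive t (1 : R) H (h t)) ->
  (forall t, x <= t <= y -> f t <= h t) -> F y - F x <= H y - H x.
Proof.
move=> xy dF dH fh.
have dHF t : is_derive t (1 : R) (H - F) (h t - f t) by apply: is_deriveB.
have cHF : {within `[x, y], continuous (H - F)}.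
  apply: continuous_subspaceT => t.
  by apply/differentiable_continuous/derivable1_diffP; exact: (@ex_derive _ _ _ _ _ _ _ (dHF t)).
have [t txy] := MVT_segment xy (fun t _ => dHF t) cHF.
rewrite /= => E; have : 0 <= (h t - f t) * (y - x).
  rewrite mulr_ge0 ?subr_ge0 // fh //.
rewrite -E; rewrite !fctE; lra.
Qed.

Lemma norm_diff_derive_le (F f H h : R -> R) (x y : R) : x <= y ->
  (forall t, is_derive t (1 : R) F (f t)) -> (forall t, is_derive t (1 : R) H (h t)) ->
  (forall t, x <= t <= y -> `|f t| <= h t) -> `|F y - F x| <= H y - H x.
Proof.
move=> xy dF dH fh.
have dNF t : is_derive t (1 : R) (- F) (- f t) by apply: is_deriveN.
have h1 := ler_diff_derive xy dF dH (fun t txy => le_trans (ler_norm _) (fh t txy)).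
have h2 : (- F) y - (- F) x <= H y - H x.
  apply: (ler_diff_derive xy dNF dH) => t txy.
  by rewrite (le_trans _ (fh t txy)) // -normrN ler_norm.
rewrite ler_norml; move: h2; rewrite !fctE; lra.
Qed.

(** From sin <= 1 follows cos t >= 1 - t, hence sin x >= x - x^2/2, which is at least x/2 for x in
    [0, 1]. *)
Lemma sin_ge_half (x : R) : 0 <= x <= 1 -> x / 2 <= sin x.
Proof.
move=> /andP[x0 x1].
have c1 (t : R) : 0 <= t -> 1 - t <= cos t.
  move=> t0.
  have dS u : is_derive u (1 : R) (fun v : R => - cos v) (sin u).
    by have := is_deriveN (is_derive_cos u); rewrite opprK.
  have := ler_diff_derive t0 dS (fun u => is_derive_id u 1) (fun u _ => sin_le1 u).
  by rewrite cos0 subr0; lra.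
have dP u : is_derive u (1 : R) (fun v : R => v - v ^+ 2 / 2) (1 - u).
  by apply: trigger_derive; rewrite /GRing.scale /=; field.
have := ler_diff_derive x0 dP (@is_derive_sin R) (fun u ux => c1 u (proj1 (andP ux))).
rewrite sin0; nra.
Qed.

(** The symmetry y -> pi - y reduces to y <= pi/2, where sin increases. *)
Lemma sin_ge_half_itv (x y : R) : 0 <= x <= 1 -> x <= y <= pi - x -> x / 2 <= sin y.
Proof.
move=> x01; have /andP[x0 x1] := x01; have p1 := pihalf_ge1 R.
suff H z : x <= z <= pi / 2 -> x / 2 <= sin z.
  move=> /andP[xy yx]; have [yp|yp] := leP y (pi / 2); first by apply: H; lra.
  have -> : sin y = sin (pi - y).
    by rewrite sinB sinpi cospi mul0r sub0r mulN1r opprK.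
  by apply: H; lra.
move=> /andP[xz zp]; apply: le_trans (sin_ge_half x01) _.
have [->|xz'] := eqVneq x z; first exact: lexx.
by rewrite ltW // ltr_sin ?in_itv /=; lra.
Qed.

Lemma sin_natpi (k : nat) : sin (k%:R * pi) = 0 :> R.
Proof.
elim: k => [|k IH]; first by rewrite mul0r sin0.
by rewrite -natr1 mulrDl mul1r sinD sinpi mulr0 IH mul0r addr0.
Qed.

Definition cos_prim (j m : nat) (x : R) : R :=
  if j == m then x else sin ((j%:R - m%:R) * x) / (j%:R - m%:R).

Lemma is_derive_cos_prim (j m : nat) (x : R) :
  is_derive x (1 : R) (cos_prim j m) (cos ((j%:R - m%:R) * x)).
Proof.
rewrite /cos_prim; have [->|jm] := eqVneq j m.
  by rewrite subrr mul0r cos0; exact: is_derive_id.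
have nz : j%:R - m%:R != 0 :> R by rewrite subr_eq0 eqr_nat.
by apply: trigger_derive; rewrite /GRing.scale /=; field; rewrite nz.
Qed.

(** Orthogonality of the cosines on [0, pi]: only the m-th coefficient survives, which plays the
    role of Cauchy's formula. *)
Lemma cos_prim_pi (j m : nat) : cos_prim j m pi = (j == m)%:R * pi.
Proof.
rewrite /cos_prim; case: eqVneq => _; rewrite ?mul1r // mulrBl sinB.
by rewrite !sin_natpi mul0r mulr0 subrr !mul0r.
Qed.

Lemma cos_prim0 (j m : nat) : cos_prim j m 0 = 0.
Proof. by rewrite /cos_prim mulr0 sin0 mul0r if_same. Qed.

End DerivativeComparison.

(** * Bound on the coefficients of [wigner_poly] *)

Section WignerCoefBound.
Variable R : realType.

Lemma horner_jweight (a b : nat) (x : R) : (jweight R a b).[x] = x ^+ a * (1 - x) ^+ b.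
Proof. by rewrite /jweight !hornerE. Qed.

Lemma jweight_prim_itv (a b : nat) (x : R) : 0 <= x <= 1 ->
  0 <= (primitive (jweight R a b)).[x] <= pint (jweight R a b).
Proof.
move=> /andP[x0 x1].
have dP t : is_derive t (1 : R) (horner (primitive (jweight R a b))) (jweight R a b).[t].
  by rewrite -[in X in is_derive _ _ _ X](deriv_primitive (jweight R a b)); exact: is_derive_poly.
have d0 t : is_derive t (1 : R) (cst 0 : R -> R) 0 by exact: is_derive_cst.
have W0 t : 0 <= t <= 1 -> 0 <= (jweight R a b).[t].
  by move=> /andP[t0 t1]; rewrite horner_jweight mulr_ge0 ?exprn_ge0 // subr_ge0.
have h1 := @ler_diff_derive _ _ _ _ _ _ _ x0 d0 dP (fun t tx => W0 t ltac:(lra)).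
have h2 := @ler_diff_derive _ _ _ _ _ _ _ x1 d0 dP (fun t tx => W0 t ltac:(lra)).
move: h1 h2; rewrite /cst horner_primitive0 /pint; lra.
Qed.

(* Arithmetic-geometric mean inequality in each factor. *)
Lemma jweight_midpoint (a b : nat) (x y : R) : 0 <= x <= 1 -> 0 <= y <= 1 ->
  (jweight R a b).[x] * (jweight R a b).[y] <= (jweight R a b).[(x + y) / 2] ^+ 2.
Proof.
move=> x01 y01; rewrite !horner_jweight mulrACA -!exprMn.
set w := (x + y) / 2.
have -> : (w ^+ a * (1 - w) ^+ b) ^+ 2 = (w ^+ 2) ^+ a * ((1 - w) ^+ 2) ^+ b.
  by rewrite exprMn -!exprM ![(_ * 2)%N]mulnC.
have xy0 : 0 <= x * y by rewrite mulr_ge0 //; lra.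
have xy1 : 0 <= (1 - x) * (1 - y) by rewrite mulr_ge0 //; lra.
have d0 := sqr_ge0 (x - y).
apply: ler_pM; rewrite ?exprn_ge0 //; apply: lerXn2r; rewrite ?nnegrE ?sqr_ge0 //;
  rewrite /w; nra.
Qed.

(* The integrand of the contour integral of the coefficient is at most
   K sqrt(G(u)), G being the Beta weight and u an affine function of cos phi.
   If G is maximal at k, this is at most K sqrt(G(k)), used for |sin phi|
   small, and at most K G((u + k) / 2) / sqrt(G(k)), used elsewhere because
   G((u + k) / 2) sin phi has an explicit primitive. *)
Lemma wigner_poly_coef_le (a b m : nat) (c s r : R) :
  (m <= a + b)%N -> 0 < c -> 0 < s -> 0 < r -> c ^+ 2 + s ^+ 2 = 1 ->
  (wigner_poly a b c s)`_m ^+ 2 * r ^+ (2 * m + 1) * (2 * c * s) <=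
  9 * (1 + r ^+ 2) ^+ (a + b).+1 * pint (jweight R a b).
Proof.
move=> mab c0 s0 r0 cs1.
set P := wigner_poly a b c s.
pose G := jweight R a b.
(* As c^2 + s^2 = 1, the two bases in [trig_poly_bound] add up to [rho]; divided by [rho] they
   become [u phi] and [1 - u phi]. *)
pose rho := 1 + r ^+ 2; have rho0 : 0 < rho by rewrite /rho; nra.
pose S := 2 * c * s * r / rho.
have S0 : 0 < S by rewrite divr_gt0 ?mulr_gt0.
pose A := (c ^+ 2 * r ^+ 2 + s ^+ 2) / rho.
pose u phi := A + S * cos phi.
pose f phi := \sum_(j < (a + b).+1) P`_j * r ^+ j * cos ((j%:R - m%:R) * phi).
(* This primitive of [f] vanishes at 0 and equals pi P_m r^m at pi, so bounding its increment bounds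
   the coefficient. *)
pose F := \sum_(j < (a + b).+1) (P`_j * r ^+ j \*: cos_prim j m : R -> R).
have dF phi : is_derive phi (1 : R) F (f phi).
  apply: is_derive_sum => j; apply: is_deriveZ; exact: is_derive_cos_prim.
have FE phi : F phi = \sum_(j < (a + b).+1) P`_j * r ^+ j * cos_prim j m phi.
  by rewrite /F fct_sumE.
have F0 : F 0 = 0.
  by rewrite FE big1 // => j _; rewrite cos_prim0 mulr0.
have Fpi : F pi = P`_m * r ^+ m * pi.
  rewrite FE (bigD1 (Ordinal (mab : m < (a + b).+1)%N)) //= cos_prim_pi eqxx mul1r.
  rewrite big1 ?addr0 // => j /negPf jm; rewrite cos_prim_pi.
  by have -> : (j == m :> nat) = false; [exact: jm|rewrite mul0r mulr0].
have uE phi : c ^+ 2 * r ^+ 2 + s ^+ 2 + 2 * c * s * r * cos phi = rho * u phi.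
  by rewrite /u /A /S; field; rewrite gt_eqF.
have u1E phi : c ^+ 2 + s ^+ 2 * r ^+ 2 - 2 * c * s * r * cos phi = rho * (1 - u phi).
  rewrite mulrBr mulr1 -uE /rho.
  have -> : c ^+ 2 = 1 - s ^+ 2 by lra.
  ring.
have csr : 0 < c * s * r by rewrite !mulr_gt0.
have u01 phi : 0 <= u phi <= 1.
  have := cos_le1 phi; have := cos_geN1 phi => h1 h2.
  rewrite -[u phi <= 1]subr_ge0 -(pmulr_rge0 (u phi) rho0) -uE.
  rewrite -(pmulr_rge0 (1 - u phi) rho0) -u1E.
  have p1 : 0 <= c * s * r * (1 + cos phi) by rewrite mulr_ge0 //; lra.
  have p2 : 0 <= c * s * r * (1 - cos phi) by rewrite mulr_ge0 //; lra.
  have q1 := sqr_ge0 (c * r - s); have q2 := sqr_ge0 (c - s * r).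
  apply/andP; split; nra.
have f2 phi : f phi ^+ 2 <= rho ^+ (a + b) * G.[u phi].
  apply: le_trans (trig_poly_bound _ _ _ _ _ _ _) _.
  by rewrite uE u1E !exprMn exprD mulrACA horner_jweight.
pose K := Num.sqrt (rho ^+ (a + b)).
have K0 : 0 < K by rewrite sqrtr_gt0 exprn_gt0.
have K2 : K ^+ 2 = rho ^+ (a + b) by rewrite sqr_sqrtr // exprn_ge0 // ltW.
have cG : {within `[0, 1], continuous (horner G)}.
  by apply: continuous_subspaceT; exact: continuous_horner.
have [k k01 kmax] := EVT_max (@ler01 R) cG.
have Gk0 : 0 < G.[k].
  apply: lt_le_trans (kmax 2^-1 _); last by rewrite in_itv /=; lra.
  by rewrite horner_jweight mulr_gt0 // exprn_gt0 //; lra.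
rewrite in_itv /= in k01.
pose M := Num.sqrt G.[k].
have M0 : 0 < M by rewrite sqrtr_gt0.
have M2 : M ^+ 2 = G.[k] by rewrite sqr_sqrtr // ltW.
have absle (x y : R) : 0 <= y -> x ^+ 2 <= y ^+ 2 -> `|x| <= y.
  by move=> y0 xy; rewrite -(ler_pXn2r (ltn0Sn 1)) ?nnegrE // real_normK ?num_real.
have fM phi : `|f phi| <= K * M.
  apply: absle; first by rewrite mulr_ge0 // ltW.
  rewrite exprMn K2 M2; apply: le_trans (f2 phi) _.
  by rewrite ler_wpM2l ?exprn_ge0 ?(ltW rho0) // kmax // in_itv /=.
have G0 x : 0 <= x <= 1 -> 0 <= G.[x].
  by move=> x01; rewrite horner_jweight mulr_ge0 // exprn_ge0 //; lra.
have v01 phi : 0 <= (u phi + k) / 2 <= 1 by have := u01 phi; lra.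
(* After squaring: f^2 G(k) <= K^2 G(u) G(k) <= K^2 G((u + k)/2)^2. *)
have fG phi : `|f phi| * M <= K * G.[(u phi + k) / 2].
  rewrite -[M]gtr0_norm // -normrM; apply: absle.
    by rewrite mulr_ge0 ?G0 // ltW.
  rewrite !exprMn M2 K2.
  apply: le_trans (ler_wpM2r (ltW Gk0) (f2 phi)) _.
  rewrite -mulrA ler_wpM2l ?exprn_ge0 ?(ltW rho0) //.
  exact: jweight_midpoint.
pose H phi : R := (primitive G).[(u phi + k) / 2].
have dH phi : is_derive phi (1 : R) H (- (S / 2) * (G.[(u phi + k) / 2] * sin phi)).
  have du : is_derive phi (1 : R) (fun t => (u t + k) / 2) (- (S / 2) * sin phi).
    by apply: trigger_derive; rewrite /GRing.scale /=; field.
  have dp := is_derive_poly (primitive G) ((u phi + k) / 2).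
  have := @is_derive1_comp _ (horner (primitive G)) (fun t => (u t + k) / 2) _ _ _ dp du.
  rewrite deriv_primitive => h; apply: trigger_derive h _.
  by rewrite /GRing.scale /=; ring.
pose I := pint G.
have I0 : 0 < I by rewrite /I pint_beta divr_gt0 // ltr0n ?muln_gt0 ?fact_gt0.
have HI phi : 0 <= H phi <= I by exact: jweight_prim_itv.
pose q := Num.sqrt (I / S).
have q0 : 0 < q by rewrite sqrtr_gt0 divr_gt0.
have q2 : q ^+ 2 = I / S by rewrite sqr_sqrtr // ltW // divr_gt0.
have pi2 := pi_ge2 R; have pih := pihalf_ge1 R.
have dL t : is_derive t (1 : R) (fun t => K * M * t) (K * M).
  by apply: trigger_derive; rewrite /GRing.scale /=; ring.
have KM0 : 0 < K * M by rewrite mulr_gt0.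
(* The increment of [F] will be at most 6 K q; dividing by pi >= 2 leaves 3, whose square is the 9
   of the statement. *)
suff main : `|P`_m * r ^+ m| <= 3 * K * q.
  have : (P`_m * r ^+ m) ^+ 2 <= (3 * K * q) ^+ 2.
    rewrite -[leLHS]real_normK ?num_real //; apply: lerXn2r => //; rewrite nnegrE //.
    by rewrite !mulr_ge0 // ltW.
  rewrite !exprMn K2 q2 => h.
  have S1 : 0 <= r * (2 * c * s) by rewrite ltW // !mulr_gt0.
  have := ler_wpM2r S1 h.
  have -> : r ^+ (2 * m + 1) = r * (r ^+ m) ^+ 2.
    by rewrite addn1 exprS mulnC exprM.
  rewrite -/I -/rho [rho ^+ _.+1]exprS.
  rewrite [leLHS](_ : _ = P`_m ^+ 2 * (r * (r ^+ m) ^+ 2) * (2 * c * s)); last by ring.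
  move=> /le_trans; apply; rewrite le_eqVlt; apply/orP; left; apply/eqP.
  by rewrite /S; field; rewrite !gt_eqF.
have Pmpi : `|P`_m * r ^+ m| * pi = `|F pi - F 0|.
  by rewrite F0 subr0 Fpi [RHS]normrM (ger0_norm (pi_ge0 R)).
(* If M < q, the trivial bound K M on all of [0, pi] is enough; otherwise the cutoff below is at
   most 1, as the lower bound on sin requires. *)
have [qM|Mq] := leP q M; last first.
  have := norm_diff_derive_le (pi_ge0 R) dF dL (fun t _ => fM t).
  rewrite -Pmpi mulr0 subr0 ler_pM2r ?pi_gt0 // => /le_trans; apply.
  have : K * M <= K * q by rewrite ler_wpM2l // ltW.
  have : 0 < K * q by rewrite mulr_gt0.
  lra.
(* The cutoff balances the pieces: each end interval contributes K M eta = K q, the middle at most 4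
   K I / (S q) = 4 K q. *)
pose eta := q / M.
have eta0 : 0 < eta by rewrite divr_gt0.
have eta1 : eta <= 1 by rewrite ler_pdivrMr // mul1r.
have Meta : M * eta = q by rewrite /eta mulrC divfK // gt_eqF.
have b1 : `|F eta - F 0| <= K * q.
  have := norm_diff_derive_le (ltW eta0) dF dL (fun t _ => fM t).
  by rewrite mulr0 subr0 -mulrA Meta.
have b3 : `|F pi - F (pi - eta)| <= K * q.
  have le3 : pi - eta <= pi by lra.
  have := norm_diff_derive_le le3 dF dL (fun t _ => fM t).
  by rewrite -mulrBr subKr -mulrA Meta.
(* Scaled so that the derivative of w H is K G / M times sin t / (eta/2), a factor at least 1 on
   [eta, pi - eta]. *)
pose w := - (4 * K / (S * q)).
have dHm t : is_derive t (1 : R) (fun t => w * H t)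
    (K * G.[(u t + k) / 2] / M * (sin t / (eta / 2))).
  apply: trigger_derive; rewrite /GRing.scale /= /w -Meta; field.
  by rewrite !gt_eqF.
have b2 : `|F (pi - eta) - F eta| <= 4 * K * q.
  have le2 : eta <= pi - eta by lra.
  apply: le_trans (norm_diff_derive_le le2 dF dHm _) _ => [t tx|].
    have e01 : 0 <= eta <= 1 by rewrite ltW.
    have := sin_ge_half_itv e01 tx => sge.
    have s1 : 1 <= sin t / (eta / 2) by rewrite ler_pdivlMr ?mul1r // divr_gt0.
    have f1 : `|f t| <= K * G.[(u t + k) / 2] / M by rewrite ler_pdivlMr.
    apply: le_trans f1 _; rewrite ler_peMr // divr_ge0 ?(ltW M0) //.
    by rewrite mulr_ge0 ?G0 // ltW.
  have /andP[h1 h2] := HI eta; have /andP[h3 h4] := HI (pi - eta).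
  have -> : 4 * K * q = 4 * K / (S * q) * I.
    have -> : I = S * q ^+ 2 by rewrite q2 mulrC divfK // gt_eqF.
    by field; rewrite !gt_eqF.
  have w0 : 0 <= 4 * K / (S * q) by rewrite ltW // divr_gt0 // mulr_gt0.
  rewrite /w !mulNr opprK addrC -mulrBr ler_wpM2l //; lra.
have tri : `|F pi - F 0| <= K * q + 4 * K * q + K * q.
  have -> : F pi - F 0 = (F eta - F 0) + (F (pi - eta) - F eta) + (F pi - F (pi - eta)) by ring.
  apply: le_trans (ler_normD _ _) _; apply: lerD b3.
  by apply: le_trans (ler_normD _ _) _; apply: lerD b1 b2.
have n0 : 0 <= `|P`_m * r ^+ m| by [].
rewrite -Pmpi in tri; nra.
Qed.


End WignerCoefBound.

(** * The uniform bound on Wigner d-functions *)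

Section WignerBound.
Variable R : realType.

Lemma jacobiE (n a b : nat) (y : R) :
  (jacobi R n a b).[1 - 2 * y] = (jacobi01 R n a b).[y].
Proof.
rewrite /jacobi /jacobi01 !horner_sum; apply: eq_bigr => s _.
have e1 : 2^-1 * (1 - 2 * y - 1) = - y by field.
have e2 : 2^-1 * (1 - 2 * y + 1) = 1 - y by field.
by rewrite !hornerE e1 e2.
Qed.

Lemma cos_half (t : R) : cos t = 1 - 2 * sin (t / 2) ^+ 2.
Proof.
have -> : cos t = cos (t / 2 *+ 2) by congr cos; rewrite -mulr_natr divfK.
by rewrite cos_mulr2n cos2sin2; ring.
Qed.

Lemma sin_half (t : R) : sin t = 2 * sin (t / 2) * cos (t / 2).
Proof.
have -> : sin t = sin (t / 2 *+ 2) by congr sin; rewrite -mulr_natr divfK.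
by rewrite sin_mulr2n -mulr_natr; ring.
Qed.

Lemma coef_linear_exp (u v : R) (p j : nat) :
  ((u *: 'X + v%:P) ^+ p)`_j = 'C(p, j)%:R * u ^+ j * v ^+ (p - j).
Proof.
rewrite addrC exprDn coef_sum.
have E i : (v%:P ^+ (p - i) * (u *: 'X) ^+ i *+ 'C(p, i) : {poly R})`_j
   = (i == j)%:R * ('C(p, j)%:R * u ^+ j * v ^+ (p - j)).
  rewrite coefMn -rmorphXn exprZn mul_polyC !coefZ coefXn -[LHS]mulr_natr eq_sym.
  by case: eqVneq => [->|_]; rewrite ?mul1r ?mulr1 ?mulr0 ?mul0r //; ring.
have [jp|pj] := leqP j p.
  rewrite (bigD1 (Ordinal (jp : j < p.+1)%N)) //= E eqxx mul1r big1 ?addr0 // => i ij.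
  by rewrite E (_ : (i == j :> nat) = false) ?mul0r //; exact: negbTE.
rewrite big1 => [|i _]; first by rewrite bin_small // !mul0r.
by rewrite E bin_small // !mul0r mulr0.
Qed.

(** Term i of the convolution giving the coefficient carries s^(mu + 2i) c^(la + 2(n - i)), hence is
    summand i of [jacobi01] at s^2, where 1 - s^2 = c^2. *)
Lemma jacobi_coef (n mu la : nat) (c s : R) : c ^+ 2 + s ^+ 2 = 1 ->
  s ^+ mu * c ^+ la * (jacobi01 R n mu la).[s ^+ 2]
  = (wigner_poly (n + mu) (n + la) c s)`_n.
Proof.
move=> cs1; rewrite /wigner_poly.
have -> : c%:P - s *: 'X = (- s) *: 'X + c%:P by rewrite scaleNr addrC.
rewrite coefMr /jacobi01 horner_sum mulr_sumr; apply: eq_bigr => i _.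
have ile : (i <= n)%N by rewrite -ltnS.
rewrite !coef_linear_exp !hornerE /=.
have -> : 1 - s ^+ 2 = c ^+ 2 by lra.
have -> : (n + mu - (n - i) = mu + i)%N by lia.
have -> : (n + la - i = la + (n - i))%N by lia.
rewrite !exprD natrM -!exprM.
have -> : (- s) ^+ i = (-1) ^+ i * s ^+ i by rewrite -exprMn mulN1r.
have -> : (- s ^+ 2) ^+ i = (-1) ^+ i * (s ^+ i * s ^+ i).
  by rewrite -exprMn -exprMn -expr2 mulN1r.
have -> : c ^+ (2 * (n - i)) = c ^+ (n - i) * c ^+ (n - i) by rewrite mul2n -addnn exprD.
ring.
Qed.

Definition wigner_Gamma (al mu la : nat) : R :=
  (al`! * (al + mu + la)`!)%:R / ((al + mu)`! * (al + la)`!)%:R.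

Lemma wigner_Gamma_ge0 al mu la : 0 <= wigner_Gamma al mu la.
Proof. by rewrite divr_ge0. Qed.

(** Trades the truncated subtraction and halving in alpha for a variable subject to a linear
    equation. *)
Lemma wigner_orders (l : nat) (k n : int) : (absz k <= l)%N -> (absz n <= l)%N ->
  exists al : nat, (l - (absz (k - n)%R + absz (k + n)%R)./2)%N = al /\
   (2 * al + absz (k - n)%R + absz (k + n)%R = 2 * l)%N.
Proof. by move=> kl nl; eexists; split; [reflexivity|lia]. Qed.

Lemma wigner_omega_sqr (k n : int) : 
  (if k <= n then 1 else (-1) ^ (n - k) : R) ^+ 2 = 1.
Proof.
case: ifP => _; first by rewrite expr1n.
by rewrite exprnP exprz_exp mulrC -exprz_exp -exprnP sqrrN expr1n exp1rz.
Qed.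

Lemma wigner_dE (l : nat) (k n : int) (t : R) :
  let mu := absz (k - n)%R in let la := absz (k + n)%R in
  let al := (l - (mu + la)./2)%N in
  wigner_d l k n t = (if k <= n then 1 else (-1) ^ (n - k))
    * Num.sqrt (wigner_Gamma al mu la)
    * (sin (t / 2) ^+ mu * cos (t / 2) ^+ la * (jacobi01 R al mu la).[sin (t / 2) ^+ 2]).
Proof. by rewrite /wigner_d /= (cos_half t) jacobiE !mulrA. Qed.

Lemma peak_exponents (x y : R) (m p : nat) :
  ((x / y) ^+ (m + p).+1) ^+ 2
    = x ^+ (2 * (m + p) + 2) / (y ^+ (2 * m + 1) * y ^+ (2 * p + 1)).
Proof. by rewrite -exprM expr_div_n -exprD; congr (_ ^+ _ / _ ^+ _); lia. Qed.

(** The factor 81 is the square of the 9 in [wigner_poly_coef_le], and 8 comes from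
    [binomial_peak]. *)
Lemma wigner_d_bound (l : nat) (k n : int) (t : R) :
  (absz k <= l)%N -> (absz n <= l)%N -> 0 <= t <= pi ->
  (sin t * wigner_d l k n t ^+ 2) ^+ 2 <= 81 * 8 / (2 * l).+1%:R.
Proof.
move=> kl nl t0pi.
have [al [E]] := wigner_orders kl nl.
rewrite wigner_dE E {E kl nl}.
move: (absz (k - n)%R) (absz (k + n)%R) => mu la El.
pose m := al; pose p := (al + mu + la)%N.
have mpE : (m + p = 2 * l)%N by rewrite /m /p; lia.
have abE : (al + mu + (al + la) = m + p)%N by rewrite /m /p; lia.
have mpS : ((m + p).+2 = p.+1 + m.+1)%N by lia.
have /andP[t0 tpi] := t0pi.
set c := cos (t / 2); set s := sin (t / 2).
have cs1 : c ^+ 2 + s ^+ 2 = 1 by exact: cos2Dsin2.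
have B0 : 0 <= 81 * 8 / (2 * l).+1%:R :> R by rewrite divr_ge0 ?mulr_ge0 ?ler0n.
(* The coefficient bound needs c and s positive; at the endpoints sin t = 0. *)
have [->|tn0] := eqVneq t 0; first by rewrite sin0 mul0r expr0n.
have [->|tnpi] := eqVneq t pi; first by rewrite sinpi mul0r expr0n.
have t0' : 0 < t by rewrite lt_neqAle eq_sym tn0.
have tpi' : t < pi by rewrite lt_neqAle tnpi.
have c0 : 0 < c by apply: cos_gt0_pihalf; lra.
have s0 : 0 < s by apply: sin_gt0_pihalf; lra.
rewrite jacobi_coef // sin_half -/c -/s; set P := _`_al.
rewrite [X in (_ * X) ^+ 2](_ : _ = wigner_Gamma al mu la * P ^+ 2); last first.
  by rewrite !exprMn wigner_omega_sqr mul1r sqr_sqrtr ?wigner_Gamma_ge0.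
(* Then r^2 / (1 + r^2) = (m+1)/(m+p+2), the point at which [binomial_peak] evaluates the weight. *)
pose r : R := Num.sqrt (m.+1%:R / p.+1%:R).
have r0 : 0 < r by rewrite sqrtr_gt0 divr_gt0.
have r2 : r ^+ 2 = m.+1%:R / p.+1%:R by rewrite sqr_sqrtr // ltW // divr_gt0.
have := @wigner_poly_coef_le R (al + mu) (al + la) m c s r _ c0 s0 r0 cs1.
rewrite abE -/P leq_addr => /(_ isT); rewrite pint_beta abE.
have -> : 1 + r ^+ 2 = (m + p).+2%:R / p.+1%:R.
  by rewrite mpS natrD mulrDl divff ?pnatr_eq0 // r2.
set X := 2 * s * c * _.
move=> H.
have fz (i : nat) : 0 < i`!%:R :> R by rewrite ltr0n fact_gt0.
have sz (i : nat) : 0 < i.+1%:R :> R by rewrite ltr0n.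
(* The numerator (al+mu)! (al+la)! of the Beta integral cancels against the denominator of Gamma. *)
have H1 : X * r ^+ (2 * m + 1)
   <= 9 * ((m + p).+2%:R / p.+1%:R) ^+ (m + p).+1 * (m`!%:R * p`!%:R / (m + p).+1`!%:R).
  have G0 := wigner_Gamma_ge0 al mu la.
  rewrite [leLHS](_ : _ = wigner_Gamma al mu la * (P ^+ 2 * r ^+ (2 * m + 1) * (2 * c * s))); last first.
    by rewrite /X; ring.
  apply: le_trans (ler_wpM2l G0 H) _; rewrite le_eqVlt; apply/orP; left; apply/eqP.
  rewrite /wigner_Gamma -/m -/p !natrM; field.
  by rewrite !gt_eqF.
have X0 : 0 <= X.
  have sc0 : 0 <= 2 * s * c by rewrite ltW // !mulr_gt0.
  exact: mulr_ge0 sc0 (mulr_ge0 (wigner_Gamma_ge0 _ _ _) (sqr_ge0 P)).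
clearbody X.
have r0' : 0 <= r ^+ (2 * m + 1) by rewrite exprn_ge0 // ltW.
(* Squaring makes the odd power of the square root [r] rational. *)
have H2 : (X * r ^+ (2 * m + 1)) ^+ 2 <=
   (9 * ((m + p).+2%:R / p.+1%:R) ^+ (m + p).+1 * (m`!%:R * p`!%:R / (m + p).+1`!%:R)) ^+ 2.
  have XX : 0 <= X * r ^+ (2 * m + 1) by rewrite mulr_ge0.
  by apply: lerXn2r => //; rewrite nnegrE // (le_trans XX).
have B := binomial_peak R m p.
rewrite -mpE.
have rX : (r ^+ (2 * m + 1)) ^+ 2 = m.+1%:R ^+ (2 * m + 1) / p.+1%:R ^+ (2 * m + 1).
  by rewrite -exprM mulnC exprM r2 expr_div_n.
rewrite exprMn rX in H2.
rewrite 2![in leRHS]exprMn peak_exponents factS natrM expr_div_n !exprMn in H2.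
rewrite ler_pdivlMr //.
move: H2 B (exprn_gt0 (2 * m + 1) (sz m)) (exprn_gt0 (2 * m + 1) (sz p)) (exprn_gt0 (2 * p + 1) (sz p)).
move: (fz m) (fz p) (fz (m + p)%N) (sz (m + p)%N).
move: (m.+1%:R ^+ (2 * m + 1)) (p.+1%:R ^+ (2 * m + 1)) (p.+1%:R ^+ (2 * p + 1)) => x1 x2 x3.
move: ((m + p).+2%:R ^+ (2 * (m + p) + 2)) ((m + p).+1%:R : R) (m`!%:R : R) (p`!%:R : R) ((m + p)`!%:R : R).
move: (X ^+ 2) => Y y N f1 f2 f3 hf1 hf2 hf3 hN H2 B h1 h2 h3.
have H3 : Y * x1 * x3 * (N * f3) ^+ 2 <= 81 * (y * (f1 ^+ 2 * f2 ^+ 2)).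
  have d0 : 0 <= x2 * x3 * (N * f3) ^+ 2 by rewrite ltW // !mulr_gt0 // exprn_gt0 // mulr_gt0.
  have := ler_wpM2r d0 H2.
  rewrite [leLHS](_ : _ = Y * x1 * x3 * (N * f3) ^+ 2); last first.
    by field; rewrite !gt_eqF.
  move=> /le_trans; apply; rewrite le_eqVlt; apply/orP; left; apply/eqP.
  by field; rewrite !gt_eqF.
have c0' : 0 < x1 * x3 * N * f3 ^+ 2 by rewrite !mulr_gt0 // exprn_gt0.
rewrite -(ler_pM2r c0').
rewrite [leLHS](_ : _ = Y * x1 * x3 * (N * f3) ^+ 2); last by ring.
apply: le_trans H3 _; move: B; lra.
Qed.


End WignerBound.

(** * Integrals of separated functions *)

Section SigmaFiniteProduct.
Context d1 d2 (T1 : measurableType d1) (T2 : measurableType d2) (R : realType).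
Variable m1 : {sigma_finite_measure set T1 -> \bar R}.
Variable m2 : {sigma_finite_measure set T2 -> \bar R}.

(* The library's sigma-finiteness instance on [m1 \x m2] is shadowed by the one
   it declares for subprobabilities, hence this alias. *)
Definition sf_prod : set (T1 * T2) -> \bar R := (m1 \x m2)%E.

HB.instance Definition _ := Measure.on sf_prod.

(** Rectangles of finite measure, enumerated through a coding of pairs, exhaust the product; numbers
    coding no pair give the empty set. *)
Lemma sf_prod_sigma_finite : sigma_finite setT sf_prod.
Proof.
have [F TF Foo] := sigma_finiteT m1; have [G TG Goo] := sigma_finiteT m2.
exists (fun n => if (unpickle n : option (nat * nat)) is Some p
                 then F p.1 `*` G p.2 else set0).
  apply/esym; rewrite -subTset => -[x y] _.
  have [i _ Fx] : (\bigcup_i F i) x by rewrite -TF.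
  have [j _ Gy] : (\bigcup_i G i) y by rewrite -TG.
  by exists (pickle (i, j)) => //; rewrite pickleK.
move=> n; case: unpickle => [p|]; last by split => //; rewrite measure0.
have [mF Fl] := Foo p.1; have [mG Gl] := Goo p.2.
split; first exact: measurableX.
by rewrite /sf_prod product_measure1E // lte_mul_pinfty // ge0_fin_numE.
Qed.

HB.instance Definition _ :=
  Measure_isSigmaFinite.Build _ _ _ sf_prod sf_prod_sigma_finite.

End SigmaFiniteProduct.
Section SeparableIntegral.
Local Open Scope ereal_scope.
Context d1 d2 (T1 : measurableType d1) (T2 : measurableType d2) (R : realType).
Variable m1 : {sigma_finite_measure set T1 -> \bar R}.
Variable m2 : {sigma_finite_measure set T2 -> \bar R}.

Let integrable_sepT (f : T1 -> R) (g : T2 -> R) :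
  m1.-integrable setT (EFin \o f) -> m2.-integrable setT (EFin \o g) ->
  (m1 \x m2).-integrable setT (fun z => (f z.1 * g z.2)%:E).
Proof.
move=> fi gi.
have mf : measurable_fun setT f by exact/measurable_EFinP/(measurable_int m1).
have mg : measurable_fun setT g by exact/measurable_EFinP/(measurable_int m2).
have mfg : measurable_fun setT (fun z : T1 * T2 => (f z.1 * g z.2)%:E).
  by apply/measurable_EFinP/measurable_funM; exact: measurableT_comp.
apply/(integrable12ltyP m1 m2 mfg).
have /integrableP[_ gl] := gi; have /integrableP[_ fl] := fi.
pose c := \int[m2]_y `|(EFin \o g) y|.
rewrite (eq_integral (fun x => c * `|(EFin \o f) x|)); last first.
  move=> x _; rewrite muleC -ge0_integralZl //.
  - by apply: eq_integral => y _; rewrite /= normrM EFinM.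
  - by apply/measurableT_comp => //; exact/measurable_EFinP.
have c0 : 0 <= c by exact: integral_ge0.
rewrite ge0_integralZl //; last by apply/measurableT_comp => //; exact/measurable_EFinP.
by rewrite lte_mul_pinfty // ge0_fin_numE.
Qed.

Lemma integrable_sep (A : set T1) (B : set T2) (f : T1 -> R) (g : T2 -> R) :
  measurable A -> measurable B ->
  m1.-integrable A (EFin \o f) -> m2.-integrable B (EFin \o g) ->
  (m1 \x m2).-integrable (A `*` B) (EFin \o (fun z => f z.1 * g z.2)%R).
Proof.
move=> mA mB fi gi.
rewrite integrable_mkcond; last exact: measurableX.
have fi' : m1.-integrable setT (EFin \o (f \_ A)).
  by rewrite -restrict_EFin -integrable_mkcond.
have gi' : m2.-integrable setT (EFin \o (g \_ B)).
  by rewrite -restrict_EFin -integrable_mkcond.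
apply: eq_integrable (integrable_sepT fi' gi') => //= -[x y] _ /=.
rewrite !patchE in_setX /=.
by case: (x \in A); case: (y \in B) => //=; rewrite ?mul0r ?mulr0.
Qed.

(** Fubini, after extending both functions by zero to the whole spaces. *)
Lemma Rintegral_sep (A : set T1) (B : set T2) (f : T1 -> R) (g : T2 -> R) :
  measurable A -> measurable B ->
  m1.-integrable A (EFin \o f) -> m2.-integrable B (EFin \o g) ->
  (\int[m1 \x m2]_(z in A `*` B) (f z.1 * g z.2) =
   (\int[m1]_(x in A) f x) * (\int[m2]_(y in B) g y))%R.
Proof.
move=> mA mB fi gi.
have fi' : m1.-integrable setT (EFin \o (f \_ A)).
  by rewrite -restrict_EFin -integrable_mkcond.
have gi' : m2.-integrable setT (EFin \o (g \_ B)).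
  by rewrite -restrict_EFin -integrable_mkcond.
rewrite Rintegral_mkcond [X in (_ = X * _)%R]Rintegral_mkcond [X in (_ = _ * X)%R]Rintegral_mkcond.
have -> : (fun z : T1 * T2 => f z.1 * g z.2)%R \_ (A `*` B)
   = (fun z => (f \_ A) z.1 * (g \_ B) z.2)%R.
  apply/funext => -[x y]; rewrite !patchE in_setX /=.
  by case: (x \in A); case: (y \in B) => //=; rewrite ?mul0r ?mulr0.
rewrite /Rintegral -(integral12_prod_meas1 (integrable_sepT fi' gi')).
have gE : \int[m2]_y ((g \_ B) y)%:E = (fine (\int[m2]_y ((g \_ B) y)%:E))%:E.
  by rewrite fineK //; exact: integrable_fin_num gi'.
have fE : \int[m1]_x ((f \_ A) x)%:E \is a fin_num by exact: integrable_fin_num fi'.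
rewrite [in LHS](eq_integral (fun x => ((f \_ A) x)%:E *
    (fine (\int[m2]_y ((g \_ B) y)%:E))%:E)); last first.
  by move=> x _; rewrite -gE /fubini_F; exact: (integralZl measurableT gi' ((f \_ A) x)).
by rewrite integralZr // fineM.
Qed.

End SeparableIntegral.

(** * One-dimensional integrals in the three Euler angles *)

Section RealIntegrals.
Variable R : realType.
Notation L := (@lebesgue_measure R).

Lemma integrable_continuous_cc (f : R -> R) (a b : R) : continuous f ->
  L.-integrable `[a, b] (EFin \o f).
Proof.
move=> cf; apply: continuous_compact_integrable; first exact: segment_compact.
exact: continuous_subspaceT.
Qed.

Lemma integrable_continuous_co (f : R -> R) (a b : R) : continuous f ->
  L.-integrable `[a, b[ (EFin \o f).
Proof.
move=> cf; apply: integrableS (integrable_continuous_cc a b cf) => //.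
by apply: subset_itvl; rewrite bnd_simp.
Qed.

Lemma Rintegral_derive (f F : R -> R) (a b : R) : a < b ->
  (forall x, is_derive x (1 : R) F (f x)) -> continuous f ->
  \int[L]_(x in `[a, b]) f x = F b - F a.
Proof.
move=> ab dF cf.
have cF : continuous F.
  by move=> x; apply/differentiable_continuous/derivable1_diffP; exact: (@ex_derive _ _ _ _ _ _ _ (dF x)).
rewrite /Rintegral (continuous_FTC2 ab (F := F)) //.
- exact: continuous_subspaceT.
- split.
  + by move=> x _; exact: (@ex_derive _ _ _ _ _ _ _ (dF x)).
  + by apply: cvg_at_right_filter; exact: cF.
  + by apply: cvg_at_left_filter; exact: cF.
- by move=> x _; rewrite derive1E (@derive_val _ _ _ _ _ _ _ (dF x)).
Qed.

Lemma Rintegral_co_cc (f : R -> R) (a b : R) : continuous f ->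
  \int[L]_(x in `[a, b[) f x = \int[L]_(x in `[a, b]) f x.
Proof.
by move=> cf; apply: Rintegral_itv_bndo_bndc; exact: integrable_continuous_co.
Qed.

Lemma continuous_cosM (k : R) : continuous (fun x : R => cos (k * x)).
Proof.
move=> x; apply: (@continuous_comp _ _ _ (fun x => k * x) cos); last exact: continuous_cos.
exact: mulrl_continuous.
Qed.

Lemma continuous_sinM (k : R) : continuous (fun x : R => sin (k * x)).
Proof.
move=> x; apply: (@continuous_comp _ _ _ (fun x => k * x) sin); last exact: continuous_sin.
exact: mulrl_continuous.
Qed.

Lemma cos_sin_2intpi (k : int) :
  cos (k%:~R * (2 * pi)) = 1 :> R /\ sin (k%:~R * (2 * pi)) = 0 :> R.
Proof.
have H (n : nat) : cos (n%:R * (2 * pi)) = 1 :> R /\ sin (n%:R * (2 * pi)) = 0 :> R.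
  elim: n => [|n [IHc IHs]]; first by rewrite mul0r cos0 sin0.
  rewrite -natr1 mulrDl mul1r cosD sinD IHc IHs [2 * pi]mulr_natl cos2pi sin2pi.
  by split; ring.
case: k => n; first exact: H.
by rewrite NegzE mulrNz mulNr cosN sinN; have [-> ->] := H n.+1; rewrite oppr0.
Qed.

Lemma Rintegral_cos_int (k : int) :
  \int[L]_(x in `[0, 2 * pi[) cos (k%:~R * x) = (k == 0)%:R * (2 * pi).
Proof.
have p0 : 0 < 2 * pi :> R by rewrite mulr_gt0 ?pi_gt0.
rewrite Rintegral_co_cc; last exact: continuous_cosM.
have [->|k0] := eqVneq k 0.
  have dF x : is_derive x (1 : R) id (cos (0%:~R * x)).
    by rewrite mul0r cos0; exact: is_derive_id.
  by rewrite (Rintegral_derive p0 dF (@continuous_cosM _)) subr0 mul1r.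
have nz : k%:~R != 0 :> R by rewrite intr_eq0.
have dF x : is_derive x (1 : R) (fun x => sin (k%:~R * x) / k%:~R) (cos (k%:~R * x)).
  by apply: trigger_derive; rewrite /GRing.scale /=; field; rewrite nz.
rewrite (Rintegral_derive p0 dF (@continuous_cosM _)).
by rewrite (cos_sin_2intpi k).2 mulr0 sin0 !mul0r subrr.
Qed.

Lemma Rintegral_sin_int (k : int) :
  \int[L]_(x in `[0, 2 * pi[) sin (k%:~R * x) = 0.
Proof.
have p0 : 0 < 2 * pi :> R by rewrite mulr_gt0 ?pi_gt0.
rewrite Rintegral_co_cc; last exact: continuous_sinM.
have [->|k0] := eqVneq k 0.
  have dF x : is_derive x (1 : R) (cst 0) (sin (0%:~R * x)).
    by rewrite mul0r sin0; exact: is_derive_cst.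
  by rewrite (Rintegral_derive p0 dF (@continuous_sinM _)) subrr.
have nz : k%:~R != 0 :> R by rewrite intr_eq0.
have dF x : is_derive x (1 : R) (fun x => - cos (k%:~R * x) / k%:~R) (sin (k%:~R * x)).
  by apply: trigger_derive; rewrite /GRing.scale /=; field; rewrite nz.
rewrite (Rintegral_derive p0 dF (@continuous_sinM _)).
by rewrite (cos_sin_2intpi k).1 mulr0 cos0 subrr.
Qed.

Lemma continuous_sin_half : continuous (fun t : R => sin (t / 2)).
Proof.
move=> x; apply: (@continuous_comp _ _ _ (fun t : R => t / 2) (@sin R)); last exact: continuous_sin.
exact: mulrr_continuous.
Qed.

Lemma continuous_cos_half : continuous (fun t : R => cos (t / 2)).
Proof.
move=> x; apply: (@continuous_comp _ _ _ (fun t : R => t / 2) (@cos R)); last exact: continuous_cos.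
exact: mulrr_continuous.
Qed.

(** The substitution y = sin^2(t/2), dy = (sin t)/2 dt, carried out on a primitive. *)
Lemma Rintegral_sin_horner (p : {poly R}) :
  \int[L]_(t in `[0, pi]) (p.[sin (t / 2) ^+ 2] * sin t) = 2 * pint p.
Proof.
have dF t : is_derive t (1 : R) (fun t => 2 * (primitive p).[sin (t / 2) ^+ 2])
    (p.[sin (t / 2) ^+ 2] * sin t).
  have du : is_derive t (1 : R) (fun t => sin (t / 2) ^+ 2) (sin t / 2).
    by apply: trigger_derive; rewrite /GRing.scale /= (sin_half t); field.
  have dp := is_derive_poly (primitive p) (sin (t / 2) ^+ 2).
  have := @is_derive1_comp _ (horner (primitive p)) (fun t => sin (t / 2) ^+ 2) _ _ _ dp du.
  move/(is_deriveZ 2); rewrite deriv_primitive => h; apply: trigger_derive h _.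
  by rewrite /GRing.scale /=; field.
have cf : continuous (fun t : R => p.[sin (t / 2) ^+ 2] * sin t).
  move=> t; apply: cvgM; last exact: continuous_sin.
  apply: (@continuous_comp _ _ _ (fun t : R => sin (t / 2) ^+ 2) (horner p)); last exact: continuous_horner.
  apply: (@continuous_comp _ _ _ (fun t : R => sin (t / 2)) (fun x : R => x ^+ 2)).
    exact: continuous_sin_half.
  exact: exprn_continuous.
rewrite (Rintegral_derive (pi_gt0 R) dF cf).
by rewrite sin_pihalf expr1n mul0r sin0 expr0n /= horner_primitive0 mulr0 subr0.
Qed.

End RealIntegrals.

(** * The Wigner system *)

Section WignerOrthonormal.
Variable R : realType.
Local Open Scope complex_scope.
Notation L := (@lebesgue_measure R).

Lemma integrable_nu (f g h : R -> R) :
  continuous f -> continuous g -> continuous h ->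
  (nu R).-integrable (euler_dom R) (EFin \o (fun x : R3 R => f x.1.1 * g x.1.2 * h x.2)).
Proof.
move=> cf cg ch; rewrite /nu /euler_dom.
apply: (@integrable_sep _ _ _ _ R (sf_prod L L) L _ _ (fun z => f z.1 * g z.2) h) => //.
- exact: measurableX.
- apply: integrable_sep => //; first exact: integrable_continuous_cc.
  exact: integrable_continuous_co.
- exact: integrable_continuous_co.
Qed.

Lemma Rintegral_nu (f g h : R -> R) :
  continuous f -> continuous g -> continuous h ->
  \int[nu R]_(x in euler_dom R) (f x.1.1 * g x.1.2 * h x.2) =
  (\int[L]_(x in `[0%R, pi]) f x) * (\int[L]_(x in `[0%R, 2 * pi[) g x)
   * (\int[L]_(x in `[0%R, 2 * pi[) h x).
Proof.
move=> cf cg ch; rewrite /nu /euler_dom.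
rewrite (@Rintegral_sep _ _ _ _ R (sf_prod L L) L _ _ (fun z => f z.1 * g z.2) h) //.
- rewrite Rintegral_sep //; first exact: integrable_continuous_cc.
  exact: integrable_continuous_co.
- exact: measurableX.
- apply: integrable_sep => //; first exact: integrable_continuous_cc.
  exact: integrable_continuous_co.
- exact: integrable_continuous_co.
Qed.

Definition cintegrable (g : R3 R -> R[i]) : Prop :=
  (nu R).-integrable (euler_dom R) (EFin \o cRe g) /\
  (nu R).-integrable (euler_dom R) (EFin \o cIm g).

Lemma measurable_euler_dom : measurable (euler_dom R).
Proof. by apply: measurableX => //; exact: measurableX. Qed.

(** A form shared by the Wigner functions and by their products with conjugates, in which the orders
    subtract. *)
Definition sepfun (f : R -> R) (k n : int) (x : R3 R) : R[i] :=
  (f x.1.1)%:C * (expj (k%:~R * x.1.2) * expj (n%:~R * x.2)).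

Lemma cRe_sepfun f k n : cRe (sepfun f k n) = fun x =>
  f x.1.1 * cos (k%:~R * x.1.2) * cos (n%:~R * x.2)
  - f x.1.1 * sin (k%:~R * x.1.2) * sin (n%:~R * x.2).
Proof. by apply/funext => x; rewrite /cRe /sepfun /=; ring. Qed.

Lemma cIm_sepfun f k n : cIm (sepfun f k n) = fun x =>
  f x.1.1 * cos (k%:~R * x.1.2) * sin (n%:~R * x.2)
  + f x.1.1 * sin (k%:~R * x.1.2) * cos (n%:~R * x.2).
Proof. by apply/funext => x; rewrite /cIm /sepfun /=; ring. Qed.

Lemma cintegrable_sepfun f k n : continuous f -> cintegrable (sepfun f k n).
Proof.
move=> cf; rewrite /cintegrable cRe_sepfun cIm_sepfun.
have mD := measurable_euler_dom.
have cc i := @continuous_cosM R i%:~R; have cs i := @continuous_sinM R i%:~R.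
have iCC := integrable_nu cf (cc k) (cc n); have iSS := integrable_nu cf (cs k) (cs n).
have iCS := integrable_nu cf (cc k) (cs n); have iSC := integrable_nu cf (cs k) (cc n).
split; first exact: (integrableB mD iCC iSS).
exact: (integrableD mD iCS iSC).
Qed.

Lemma cintegral_sepfun f k n : continuous f ->
  cintegral (nu R) (euler_dom R) (sepfun f k n)
  = ((k == 0)%:R * (n == 0)%:R * (2 * pi) ^+ 2 * \int[L]_(x in `[0%R, pi]) f x)%:C.
Proof.
move=> cf; rewrite /cintegral cRe_sepfun cIm_sepfun.
have mD := measurable_euler_dom.
have cc i := @continuous_cosM R i%:~R; have cs i := @continuous_sinM R i%:~R.
have iCC := integrable_nu cf (cc k) (cc n); have iSS := integrable_nu cf (cs k) (cs n).
have iCS := integrable_nu cf (cc k) (cs n); have iSC := integrable_nu cf (cs k) (cc n).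
rewrite (RintegralB mD iCC iSS) (RintegralD mD iCS iSC).
rewrite (Rintegral_nu cf (cc k) (cc n)) (Rintegral_nu cf (cs k) (cs n)).
rewrite (Rintegral_nu cf (cc k) (cs n)) (Rintegral_nu cf (cs k) (cc n)).
rewrite !Rintegral_cos_int !Rintegral_sin_int.
apply/eqP; rewrite eq_complex /=; apply/andP; split; apply/eqP; ring.
Qed.

Definition wigner_theta (l : nat) (k n : int) (t : R) : R :=
  Num.sqrt (sin t)
  * (Num.sqrt ((2 * l + 1)%:R / (8 * pi ^+ 2)) * wigner_d l k n t).

(** This holds on the whole line, because [Num.sqrt] is continuous with value 0 on negative
    numbers. *)
Lemma continuous_wigner_theta l k n : continuous (wigner_theta l k n).
Proof.
move=> t; apply: cvgM.
  apply: (@continuous_comp _ _ _ (@sin R) (@Num.sqrt R)); first exact: continuous_sin.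
  exact: sqrt_continuous.
apply: cvgM; first exact: cvg_cst.
have -> : wigner_d l k n = fun t : R => wigner_d l k n t by [].
under [X in X @ _ --> _]eq_fun do rewrite wigner_dE.
rewrite wigner_dE.
apply: cvgM; first exact: cvg_cst.
apply: cvgM.
  apply: cvgM.
    apply: (@continuous_comp _ _ _ (fun t : R => sin (t / 2)) (fun x : R => x ^+ _)).
      exact: continuous_sin_half.
    exact: exprn_continuous.
  apply: (@continuous_comp _ _ _ (fun t : R => cos (t / 2)) (fun x : R => x ^+ _)).
    exact: continuous_cos_half.
  exact: exprn_continuous.
apply: (@continuous_comp _ _ _ (fun t : R => sin (t / 2) ^+ 2) (horner _)); last exact: continuous_horner.
apply: (@continuous_comp _ _ _ (fun t : R => sin (t / 2)) (fun x : R => x ^+ 2)).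
  exact: continuous_sin_half.
exact: exprn_continuous.
Qed.

Lemma wigner_preE (B : nat) (i : wigner_idx B) :
  wigner_pre i = sepfun (wigner_theta (idx_l i) (idx_k i) (idx_n i)) (- idx_k i) (- idx_n i).
Proof.
apply/funext => x; rewrite /wigner_pre /wigner_D /sepfun /wigner_theta.
rewrite !rmorphM /= !mulrNz !mulNr; ring.
Qed.

Lemma conjc_expj (x : R) : conjc (expj x) = expj (- x).
Proof. by rewrite /expj cosN sinN. Qed.

Lemma sepfun_mul_conj f g k n k' n' :
  (fun x => sepfun f k n x * conjc (sepfun g k' n' x))
  = sepfun (f \* g) (k - k') (n - n').
Proof.
have conjM (z w : R[i]) : conjc (z * w) = conjc z * conjc w by exact: rmorphM.
apply/funext => x; rewrite /sepfun !conjM !conjc_expj conjc_real.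
by rewrite !rmorphB !mulrBl !expjD rmorphM; ring.
Qed.

Lemma normc_sepfun f k n x :
  Normc.normc (sepfun f k n x) = `|f x.1.1|.
Proof.
rewrite /sepfun !Normc.normcM !normc_expj !mulr1 /=.
by rewrite expr0n /= addr0 sqrtr_sqr.
Qed.

Lemma in_L2_sepfun f k n : continuous f ->
  in_L2 (nu R) (euler_dom R) (sepfun f k n).
Proof.
move=> cf; have [h1 h2] := cintegrable_sepfun k n cf; split.
- exact: (measurable_EFinP _ _).1 (measurable_int _ h1).
- exact: (measurable_EFinP _ _).1 (measurable_int _ h2).
- have c1 : continuous (fun _ : R => 1 : R) by move=> ?; exact: cvg_cst.
  have cff : continuous (fun x => f x * f x).
    by move=> x; apply: cvgM; exact: cf.
  move: (integrable_nu cff c1 c1); apply: eq_integrable; first exact: measurable_euler_dom.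
  move=> x _; rewrite /comp normc_sepfun.
  by rewrite real_normK ?num_real // !mulr1 expr2.
Qed.

(** Equal orders give the same mu and lambda, so y = sin^2(t/2) leads to Jacobi orthogonality. The
    norm there is 1 / (Gamma (2l+1)), which leaves 2 / (8 pi^2); the integrals over the other two
    angles supply the missing (2 pi)^2. *)
Lemma Rintegral_wigner_theta (l l' : nat) (k n : int) :
  (absz k <= l)%N -> (absz n <= l)%N -> (absz k <= l')%N -> (absz n <= l')%N ->
  \int[L]_(t in `[0%R, pi]) (wigner_theta l k n t * wigner_theta l' k n t)
  = (l == l')%:R / (2 * pi) ^+ 2.
Proof.
move=> kl nl kl' nl'.
have [al [E El]] := wigner_orders kl nl.
have [al' [E' El']] := wigner_orders kl' nl'.
have dE := fun t => @wigner_dE R l k n t; have dE' := fun t => @wigner_dE R l' k n t.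
move: dE dE' El El'; rewrite /= E E' {E E' kl nl kl' nl'}.
move: (absz (k - n)%R) (absz (k + n)%R) (wigner_omega_sqr R k n) => mu la.
move: (if k <= n then 1 else (-1) ^ (n - k) : R) => om om2 dE dE' El El'.
pose N l : R := Num.sqrt ((2 * l + 1)%:R / (8 * pi ^+ 2)).
pose J : {poly R} := jweight R mu la * (jacobi01 R al mu la * jacobi01 R al' mu la).
pose C := N l * N l' * (Num.sqrt (wigner_Gamma R al mu la) * Num.sqrt (wigner_Gamma R al' mu la)).
(* Restricted to [0, pi], where sin t >= 0, so that the two square roots multiply to sin t; the
   signs cancel by [om2]. *)
have E0 : {in `[0, pi]%classic, (fun t : R => wigner_theta l k n t * wigner_theta l' k n t)
    =1 (fun t => C * (J.[sin (t / 2) ^+ 2] * sin t))}.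
  move=> t; rewrite inE /= in_itv /= => t0pi.
  have st0 : 0 <= sin t by exact: sin_ge0_pi.
  rewrite /wigner_theta dE dE' -/(N l) -/(N l') /C /J hornerM horner_jweight hornerM.
  have -> : 1 - sin (t / 2) ^+ 2 = cos (t / 2) ^+ 2 by rewrite cos2sin2.
  rewrite -!exprM -[X in _ = _ * (_ * X)](sqr_sqrtr st0).
  by rewrite !mul2n -!addnn !exprD -[RHS]mul1r -om2; ring.
transitivity (\int[L]_(t in `[0%R, pi]) (C * (J.[sin (t / 2) ^+ 2] * sin t))).
  exact: eq_Rintegral.
rewrite RintegralZl //; last first.
  apply: integrable_continuous_cc => t; apply: cvgM; last exact: continuous_sin.
  apply: (@continuous_comp _ _ _ (fun t : R => sin (t / 2) ^+ 2) (horner J)); last exact: continuous_horner.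
  apply: (@continuous_comp _ _ _ (fun t : R => sin (t / 2)) (fun x : R => x ^+ 2)).
    exact: continuous_sin_half.
  exact: exprn_continuous.
rewrite Rintegral_sin_horner jacobi01_orth.
have -> : (al == al') = (l == l') by lia.
have [ll|_] := eqVneq l l'; last by rewrite !mul0r !mulr0.
have {}El' : al' = al by lia.
subst l' al'.
have fz (i : nat) : i`!%:R != 0 :> R by rewrite pnatr_eq0 -lt0n fact_gt0.
have p0 : pi != 0 :> R by rewrite gt_eqF // pi_gt0.
have lz : (2 * l).+1%:R != 0 :> R by rewrite pnatr_eq0.
have -> : C = (2 * l).+1%:R / (8 * pi ^+ 2) * wigner_Gamma R al mu la.
  rewrite /C -!expr2 !sqr_sqrtr ?wigner_Gamma_ge0 ?addn1 //.
  by rewrite divr_ge0 // mulr_ge0 // sqr_ge0.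
rewrite El /wigner_Gamma !natrM.
move: lz; move: ((2 * l).+1%:R : R) (pi : R) p0 => x q p0 lz.
by field; rewrite !fz lz p0.
Qed.

End WignerOrthonormal.

(** * Orthonormality, linear independence, cardinality and size of the family *)

Section WignerFamily.
Variable R : realType.
Local Open Scope complex_scope.
Notation L := (@lebesgue_measure R).
Notation D := (euler_dom R).

Lemma idx_orders (B : nat) (i : wigner_idx B) :
  [/\ (idx_l i < B)%N, (absz (idx_k i) <= idx_l i)%N & (absz (idx_n i) <= idx_l i)%N].
Proof.
case: i => l [a b]; rewrite /idx_k /idx_n /idx_l /=.
by have := ltn_ord a; have := ltn_ord b; have := ltn_ord l; split; lia.
Qed.

Lemma idx_inj (B : nat) (i j : wigner_idx B) :
  idx_l i = idx_l j -> idx_k i = idx_k j -> idx_n i = idx_n j -> i = j.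
Proof.
case: i j => [l [a b]] [l' [a' b']]; rewrite /idx_k /idx_n /idx_l /= => ll kk nn.
have {}ll : l = l' by exact: val_inj.
subst l'; have -> : a = a' by apply: val_inj => /=; move: kk => /=; lia.
by have -> : b = b' by apply: val_inj => /=; move: nn => /=; lia.
Qed.

(** Different orders are separated by the integrals over phi and chi, different degrees by the
    integral over theta. *)
Lemma inner_wigner_pre (B : nat) (i j : wigner_idx B) :
  inner (nu R) D (wigner_pre i) (wigner_pre j) = (i == j)%:R.
Proof.
have [_ ki ni] := idx_orders i; have [_ kj nj] := idx_orders j.
rewrite /inner !wigner_preE sepfun_mul_conj cintegral_sepfun; last first.
  by move=> t; apply: cvgM; exact: continuous_wigner_theta.
rewrite !opprK ![- _ + _]addrC !subr_eq0.
have [kk|kk] := eqVneq (idx_k j) (idx_k i); last first.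
  rewrite (_ : i == j = false) ?mul0r //.
  by apply/eqP => ij; rewrite ij eqxx in kk.
have [nn|nn] := eqVneq (idx_n j) (idx_n i); last first.
  rewrite (_ : i == j = false) ?mulr0 ?mul0r //.
  by apply/eqP => ij; rewrite ij eqxx in nn.
rewrite /= kk nn Rintegral_wigner_theta // -?kk -?nn //.
have -> : (idx_l i == idx_l j) = (i == j).
  by apply/eqP/eqP => [ll|->//]; exact: idx_inj.
have p0 : (2 * pi) ^+ 2 != 0 :> R by rewrite expf_neq0 // mulf_neq0 // gt_eqF // pi_gt0.
rewrite mulr1 mul1r mulrCA mulfV // mulr1; by case: (i == j).
Qed.

Lemma orthonormal_wigner_pre (B : nat) : orthonormal_family (nu R) D (@wigner_pre R B).
Proof.
split=> [i|]; last exact: inner_wigner_pre.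
rewrite wigner_preE; apply: in_L2_sepfun; exact: continuous_wigner_theta.
Qed.

Lemma cintegralD (f g : R3 R -> R[i]) : cintegrable f -> cintegrable g ->
  cintegrable (fun x => f x + g x) /\
  cintegral (nu R) D (fun x => f x + g x) = cintegral (nu R) D f + cintegral (nu R) D g.
Proof.
move=> [f1 f2] [g1 g2]; have mD := @measurable_euler_dom R.
have eR : cRe (fun x => f x + g x) = fun x => cRe f x + cRe g x.
  by apply/funext => x; rewrite /cRe ReD.
have eI : cIm (fun x => f x + g x) = fun x => cIm f x + cIm g x.
  by apply/funext => x; rewrite /cIm; case: (f x) (g x) => ? ? [].
rewrite /cintegrable /cintegral eR eI; split.
  by split; [exact: (integrableD mD f1 g1)|exact: (integrableD mD f2 g2)].
by rewrite (RintegralD mD f1 g1) (RintegralD mD f2 g2).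
Qed.

Lemma cintegralZ (c : R[i]) (f : R3 R -> R[i]) : cintegrable f ->
  cintegrable (fun x => c * f x) /\
  cintegral (nu R) D (fun x => c * f x) = c * cintegral (nu R) D f.
Proof.
case: c => a b [f1 f2]; have mD := @measurable_euler_dom R.
have eR : cRe (fun x => (a +i* b) * f x) = fun x => a * cRe f x - b * cIm f x.
  by apply/funext => x; rewrite /cRe /cIm; case: (f x).
have eI : cIm (fun x => (a +i* b) * f x) = fun x => a * cIm f x + b * cRe f x.
  by apply/funext => x; rewrite /cRe /cIm; case: (f x).
have a1 := integrableZl mD a f1; have b1 := integrableZl mD b f1.
have a2 := integrableZl mD a f2; have b2 := integrableZl mD b f2.
rewrite /cintegrable /cintegral eR eI; split.
  by split; [exact: (integrableB mD a1 b2)|exact: (integrableD mD a2 b1)].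
rewrite (RintegralB mD a1 b2) (RintegralD mD a2 b1).
by rewrite !RintegralZl.
Qed.

Lemma cintegral_lincomb (I : Type) (r : seq I) (c : I -> R[i]) (g : I -> R3 R -> R[i]) :
  (forall i, cintegrable (g i)) ->
  cintegrable (fun x => \sum_(i <- r) c i * g i x) /\
  cintegral (nu R) D (fun x => \sum_(i <- r) c i * g i x)
  = \sum_(i <- r) c i * cintegral (nu R) D (g i).
Proof.
move=> gi; elim: r => [|i r [IH1 IH2]].
  rewrite big_nil; have -> : (fun x : R3 R => \sum_(i <- [::]) c i * g i x) = sepfun (fun _ : R => 0 : R) 0 0.
    by apply/funext => x; rewrite big_nil /sepfun mul0r.
  have c0 : continuous (fun _ : R => 0 : R) by move=> ?; exact: cvg_cst.
  split; first exact: cintegrable_sepfun.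
  by rewrite cintegral_sepfun // Rintegral_cst // mul0r mulr0.
have -> : (fun x : R3 R => \sum_(j <- i :: r) c j * g j x)
    = (fun x => c i * g i x + \sum_(j <- r) c j * g j x).
  by apply/funext => x; rewrite big_cons.
have [h1 h2] := cintegralZ (c i) (gi i).
have [h3 h4] := cintegralD h1 IH1.
by rewrite big_cons -h2 -IH2.
Qed.

(** Orthonormality recovers the coefficients from [f], whence their uniqueness. *)
Lemma lincomb_coef (B : nat) (c : {ffun wigner_idx B -> R[i]}) (f : R3 R -> R[i]) j :
  is_lincomb D (@wigner_pre R B) c f -> c j = inner (nu R) D f (wigner_pre j).
Proof.
move=> cf; rewrite /inner.
have gi i : cintegrable (fun x => @wigner_pre R B i x * conjc (wigner_pre j x)).
  rewrite !wigner_preE sepfun_mul_conj; apply: cintegrable_sepfun.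
  by move=> t; apply: cvgM; exact: continuous_wigner_theta.
have [_ E] := cintegral_lincomb (index_enum (wigner_idx B)) c gi.
have -> : cintegral (nu R) D (fun x => f x * conjc (wigner_pre j x)) =
   cintegral (nu R) D (fun x => \sum_i c i * (@wigner_pre R B i x * conjc (wigner_pre j x))).
  have e x : D x -> f x * conjc (wigner_pre j x)
     = \sum_i c i * (@wigner_pre R B i x * conjc (wigner_pre j x)).
    by move=> Dx; rewrite cf // mulr_suml; apply: eq_bigr => i _; rewrite mulrA.
  rewrite /cintegral; congr (_ +i* _); apply: eq_Rintegral => x /[!inE] Dx;
    by rewrite /cRe /cIm e.
rewrite E (eq_bigr (fun i => c i * (i == j)%:R)) => [|i _]; last first.
  by rewrite -(inner_wigner_pre i j).
rewrite (bigD1 j) //= eqxx mulr1 big1 ?addr0 // => i /negPf ij.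
by rewrite ij mulr0.
Qed.

Lemma orthonormal_basis_wigner_pre (B : nat) :
  orthonormal_basis (nu R) D (fspan D (@wigner_pre R B)) (@wigner_pre R B).
Proof.
split=> [|i|f [c cf]]; first exact: orthonormal_wigner_pre.
  exists [ffun j => (j == i)%:R] => x _; rewrite (bigD1 i) //= ffunE eqxx mul1r.
  by rewrite big1 ?addr0 // => j /negPf ji; rewrite ffunE ji mul0r.
exists c; split => // c' c'f; apply/ffunP => j.
by rewrite (lincomb_coef j cf) (lincomb_coef j c'f).
Qed.

(** The sum of the squares (2l + 1)^2 over l < B. *)
Lemma card_wigner_idx (B : nat) :
  #|wigner_idx B|%:R = B%:R * (2 * B%:R - 1) * (2 * B%:R + 1) / 3 :> R.
Proof.
rewrite /wigner_idx card_tagged sumnE big_map big_enum /=.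
under eq_bigr do rewrite card_prod card_ord.
elim: B => [|B IH]; first by rewrite big_ord0 !mul0r.
by rewrite big_ord_recr /= natrD IH natrM -[(2 * B).+1%:R]natr1 natrM -natr1; field.
Qed.

(** The squared normalization ((2l+1) / (8 pi^2))^2 times the bound on d leaves (2l+1) 81 / (8
    pi^4), and 8 pi^4 >= 128 since pi >= 2. *)
Lemma wigner_theta_le (l : nat) (k n : int) (t : R) :
  (absz k <= l)%N -> (absz n <= l)%N -> 0 <= t <= pi ->
  wigner_theta l k n t ^+ 4 <= (2 * l).+1%:R.
Proof.
move=> kl nl t0pi; have st0 : 0 <= sin t by exact: sin_ge0_pi.
have Bd := wigner_d_bound kl nl t0pi.
have lz : 0 < (2 * l).+1%:R :> R by rewrite ltr0n.
have N0 : 0 <= (2 * l + 1)%:R / (8 * pi ^+ 2) :> R by rewrite divr_ge0 // mulr_ge0 // sqr_ge0.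
have -> : wigner_theta l k n t ^+ 4
   = ((2 * l).+1%:R / (8 * pi ^+ 2)) ^+ 2 * (sin t * wigner_d l k n t ^+ 2) ^+ 2.
  rewrite -[4%N]/(2 * 2)%N exprM -exprMn; congr (_ ^+ 2).
  rewrite /wigner_theta exprMn (sqr_sqrtr st0) exprMn (sqr_sqrtr N0) addn1.
  by rewrite mulrCA.
apply: le_trans (ler_wpM2l (sqr_ge0 _) Bd) _.
have p4 : 16 <= pi ^+ 4 :> R.
  have := pi_ge2 R; move: (pi : R) => q q2; have : 4 <= q ^+ 2 by nra.
  by rewrite -[4%N]/(2 * 2)%N exprM; nra.
move: p4 (pi_gt0 R) lz; move: (pi : R) ((2 * l).+1%:R : R) => q x p4 q0 x0.
rewrite [leLHS](_ : _ = x * (81 / (8 * q ^+ 4))); last first.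
  by field; rewrite !gt_eqF.
apply: ler_piMr; first exact: ltW.
by rewrite ler_pdivrMr ?mul1r ?mulr_gt0 ?exprn_gt0 //; lra.
Qed.

End WignerFamily.

(** * From the degree bound to a power of the cardinality *)

Theorem proposition9 (R : realType) :
  exists C0 : R, 0 < C0 /\
  forall B : nat, (1 <= B)%N ->
  let N : R := B%:R * (2 * B%:R - 1) * (2 * B%:R + 1) / 3 in
  let e := @wigner_pre R B in
  [/\ #|wigner_idx B|%:R = N,
      orthonormal_family (nu R) (euler_dom R) e,
      orthonormal_basis (nu R) (euler_dom R) (fspan (euler_dom R) e) e
    & (ereal_sup [set sup_norm (euler_dom R) (e i) | i in [set: wigner_idx B]]
       <= (C0 * N `^ (1 / 12))%:E)%E].
Proof.
(* With w the polar factor, w^4 <= 2l + 1 <= 2B, so w^12 <= 8 B^3 <= 8 N <= 2^12 N. *)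
exists 2; split=> // B B1 N e; split.
- exact: card_wigner_idx.
- exact: orthonormal_wigner_pre.
- exact: orthonormal_basis_wigner_pre.
have b1 : 1 <= B%:R :> R by rewrite ler1n.
have NB : B%:R ^+ 3 <= N.
  rewrite /N; move: (B%:R : R) b1 => b b1; rewrite -subr_ge0.
  rewrite (_ : _ - _ = b * (b ^+ 2 - 1) / 3); last by field.
  rewrite divr_ge0 // mulr_ge0 //; nra.
have N0 : 0 <= N by apply: le_trans NB; rewrite exprn_ge0.
have NX : (N `^ (1 / 12)) ^+ 12 = N.
  by rewrite -powR_mulrn ?powR_ge0 // -powRrM mulfVK ?powRr1.
apply: ge_ereal_sup => _ [i _ <-]; apply: ge_ereal_sup => _ [x Dx <-].
have [lB kl nl] := idx_orders i.
rewrite lee_fin /e wigner_preE normc_sepfun.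
have /(wigner_theta_le kl nl) : 0 <= x.1.1 <= pi by case: Dx => -[/= +] _ _; rewrite in_itv.
set w := wigner_theta _ _ _ _ => w4.
have wB : w ^+ 4 <= 2 * B%:R.
  by apply: le_trans w4 _; rewrite -natrM ler_nat; lia.
(* Twelfth powers clear the real exponent 1/12 and allow the use of the bound on w^4. *)
rewrite -(@ler_pXn2r _ 12) // ?nnegrE ?mulr_ge0 ?powR_ge0 //.
rewrite exprMn NX -normrX ger0_norm; last first.
  exact: exprn_even_ge0.
rewrite -[X in w ^+ X]/(4 * 3)%N exprM.
have w0 : 0 <= w ^+ 4 by exact: exprn_even_ge0.
apply: (@le_trans _ _ ((2 * B%:R) ^+ 3)).
  by apply: lerXn2r; rewrite ?nnegrE // mulr_ge0.
rewrite exprMn; apply: ler_pM NB; rewrite ?exprn_ge0 //.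
by apply: ler_weXn2l; rewrite ?ler1n.
Qed.
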